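(* Let $f:\mathbb{R}^n\to\mathbb{R}^n$ be continuously differentiable and $q:\mathbb{R}^n\to\mathbb{R}\cup\{+\infty\}$ proper, convex and lower semicontinuous, $H=f+\partial q$, and consider the hybrid Newton–Douglas–Rachford algorithm described in the context. If $f$ is strongly monotone, then the algorithm is well defined. If, in addition, $f$ is Lipschitz continuous on $S^{(0)}=\{x:\|u_\gamma(x)\|\le\|u_\gamma(x^{(0)})\|\}$, then (for the sequences generated when the algorithm does not terminate) the sequence $(u^{(2k)})$ converges at least Q-linearly to $0$ and the sequence $(x^{(j)})$ converges at least R-linearly to the unique solution $\bar x$ of $0\in H(x)$. If moreover $H$ is semismooth$^*$ at $(\bar x,0)$, then the convergence of $(x^{(2k)})$ to $\bar x$ is Q-superlinear.
   Context: $u_\gamma(x)=\arg\min_u\bigl(\tfrac12\gamma\|u\|^2+\langle f(x),u\rangle+q(x+u)\bigr)$, $r_\gamma(x)=\sqrt{1+\gamma^2}\|u_\gamma(x)\|$. Douglas–Rachford operator: $\mathcal T^{DR}_\lambda(x)=(I+\lambda f)^{-1}\bigl((I+\lambda\partial q)^{-1}(x-\lambda f(x))+\lambda f(x)\bigr)$. Newton direction at $x$ with parameter $\gamma$: with $u=u_\gamma(x)$ choose a symmetric positive semidefinite $G$, $\|G\|\le1$, with $Gv^*\in D^*(\partial q)(x+u,-\gamma u-f(x))((I-G)v^* )$ for all $v^*$, and let $\Delta x$ solve $((I-G)\nabla f(x)+G)\Delta x=(\gamma(I-G)+G)u$. Algorithm. Input: $x^{(0)}$, $\gamma>0$, $\nu,\xi\in(0,1)$,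 $\beta_j\downarrow0$ with $\beta_0=1$, tolerance $\epsilon_{tol}>0$. Step 1: $u^{(0)}=u_\gamma(x^{(0)})$, $k=0$. Step 2: if $r_\gamma(x^{(2k)})\le\epsilon_{tol}$, stop. Step 3: $x^{(2k+1)}=\mathcal T^{DR}_{1/\gamma}(x^{(2k)})$, $u^{(2k+1)}=u_\gamma(x^{(2k+1)})$. Step 4: compute the Newton direction $\Delta x^{(2k+1)}$ at $x^{(2k+1)}$ with parameter $\gamma$ and let $\alpha^{(2k+1)}$ be the first $\beta_j$ with $\|u_\gamma(x^{(2k+1)}+\beta_j\Delta x^{(2k+1)})\|\le(1-\nu\beta_j)(\xi\|u^{(2k)}\|+(1-\xi)\|u^{(2k+1)}\|)$. Step 5: $x^{(2k+2)}=x^{(2k+1)}+\alpha^{(2k+1)}\Delta x^{(2k+1)}$, $u^{(2k+2)}=u_\gamma(x^{(2k+2)})$. Step 6: $k:=k+1$, go to Step 2. $f$ strongly monotone: $\langle f(x_1)-f(x_2),x_1-x_2\rangle\ge\mu\|x_1-x_2\|^2$ for some $\mu>0$. $D^*$ is the limiting (Mordukhovich) coderivative, $D^*F((\bar x,\bar y);(u,v))$ its directional version (defined via directional limiting normal cones: limits of regular normals to $\mathrm{gph}\,F$ at $(\bar x,\bar y)+t_k w_k$, $t_k\downarrow 0$, $w_k\to(u,v)$); $F$ is semismooth$^*$ at $(\bar x,\bar y)$ if $\langle u^*,u\rangle=\langle v^*,v\rangle$ whenever $u^*\in D^*F((\bar x,\bar y);(u,v))(v^* )$. *)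

(* Defs.v *)
From HB Require Import structures.
From mathcomp Require Import all_boot all_order all_algebra.
From mathcomp Require Import boolp classical_sets reals constructive_ereal ereal.

Set Implicit Arguments.
Unset Strict Implicit.
Unset Printing Implicit Defensive.

Import Order.TTheory GRing.Theory Num.Theory.
Local Open Scope ring_scope.

Section Defs.
Context {R : realType} {n : nat}.
Local Notation V := 'cV[R]_n.

Definition dotv (u v : V) : R := \sum_i u i ord0 * v i ord0.
Definition nrm (u : V) : R := Num.sqrt (dotv u u).

Definition psub (a b : V * V) : V * V := (a.1 - b.1, a.2 - b.2).
Definition padd (a b : V * V) : V * V := (a.1 + b.1, a.2 + b.2).
Definition pscale (t : R) (a : V * V) : V * V := (t *: a.1, t *: a.2).
Definition dotp (a b : V * V) : R := dotv a.1 b.1 + dotv a.2 b.2.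
Definition nrmp (a : V * V) : R := Num.sqrt (dotp a a).

Definition cvgV (s : nat -> V) (l : V) : Prop :=
  forall e : R, 0 < e -> exists K, forall k, (K <= k)%N -> nrm (s k - l) < e.
Definition cvgP (s : nat -> V * V) (l : V * V) : Prop :=
  forall e : R, 0 < e -> exists K, forall k, (K <= k)%N -> nrmp (psub (s k) l) < e.
Definition cvgR (s : nat -> R) (l : R) : Prop :=
  forall e : R, 0 < e -> exists K, forall k, (K <= k)%N -> `|s k - l| < e.

Definition proper_fun (q : V -> \bar R) : Prop :=
  (forall x, q x != -oo%E) /\ exists x, q x \is a fin_num.
Definition convex_fun (q : V -> \bar R) : Prop :=
  forall (x y : V) (t : R), 0 < t < 1 ->
    (q (t *: x + (1 - t) *: y)%R <= t%:E * q x + (1 - t)%:E * q y)%E.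
Definition lsc_fun (q : V -> \bar R) : Prop :=
  forall (x : V) (a : R), (a%:E < q x)%E ->
    exists d : R, 0 < d /\ forall y, nrm (y - x) < d -> (a%:E < q y)%E.

Definition subdiff (q : V -> \bar R) (x v : V) : Prop :=
  q x \is a fin_num /\
  forall y, (q x + (dotv v (y - x))%:E <= q y)%E.

Definition C1_with_jacobian (f : V -> V) (J : V -> 'M[R]_n) : Prop :=
  (forall x (e : R), 0 < e -> exists d : R, 0 < d /\
     forall y, nrm (y - x) < d -> nrm (f y - f x - J x *m (y - x)) <= e * nrm (y - x))
  /\ (forall x (i j : 'I_n) (e : R), 0 < e -> exists d : R, 0 < d /\
     forall y, nrm (y - x) < d -> `|J y i j - J x i j| < e).
Definition strongly_monotone (f : V -> V) : Prop :=
  exists mu : R, 0 < mu /\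
    forall x1 x2, dotv (f x1 - f x2) (x1 - x2) >= mu * nrm (x1 - x2) ^+ 2.
Definition lipschitz_on (f : V -> V) (S : set V) : Prop :=
  exists L : R, forall y z, S y -> S z -> nrm (f y - f z) <= L * nrm (y - z).

Definition H_map (f : V -> V) (q : V -> \bar R) (x y : V) : Prop :=
  subdiff q x (y - f x).

Definition phi_obj (gamma : R) (f : V -> V) (q : V -> \bar R) (x u : V) : \bar R :=
  ((1 / 2 * gamma * nrm u ^+ 2 + dotv (f x) u)%:E + q (x + u)%R)%E.
Definition is_u_gamma (gamma : R) (f : V -> V) (q : V -> \bar R) (x u : V) : Prop :=
  forall w, (phi_obj gamma f q x u <= phi_obj gamma f q x w)%E.
(* u_gamma(x) := the (unique, see well_defined) minimizer *)
Definition u_gamma (gamma : R) (f : V -> V) (q : V -> \bar R) (x : V) : V :=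
  xget 0 [set u | is_u_gamma gamma f q x u].
Definition r_gamma (gamma : R) (f : V -> V) (q : V -> \bar R) (x : V) : R :=
  Num.sqrt (1 + gamma ^+ 2) * nrm (u_gamma gamma f q x).

Definition resolvent_q (lam : R) (q : V -> \bar R) (w p : V) : Prop :=
  subdiff q p (lam^-1 *: (w - p)).
(* y = T^DR_lam(x) = (I + lam f)^{-1}((I + lam \partial q)^{-1}(x - lam f x) + lam f x) *)
Definition DR_rel (lam : R) (f : V -> V) (q : V -> \bar R) (x y : V) : Prop :=
  exists p, resolvent_q lam q (x - lam *: f x) p /\ y + lam *: f y = p + lam *: f x.

Definition reg_normal (Om : set (V * V)) (z w : V * V) : Prop :=
  Om z /\ forall e : R, 0 < e -> exists d : R, 0 < d /\
    forall z', Om z' -> nrmp (psub z' z) < d -> dotp w (psub z' z) <= e * nrmp (psub z' z).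
Definition lim_normal (Om : set (V * V)) (z w : V * V) : Prop :=
  Om z /\ exists (zk wk : nat -> V * V),
    (forall k, reg_normal Om (zk k) (wk k)) /\ cvgP zk z /\ cvgP wk w.
Definition dir_normal (Om : set (V * V)) (z d w : V * V) : Prop :=
  Om z /\ exists (tk : nat -> R) (dk wk : nat -> V * V),
    (forall k, 0 < tk k) /\ cvgR tk 0 /\ cvgP dk d /\ cvgP wk w /\
    (forall k, reg_normal Om (padd z (pscale (tk k) (dk k))) (wk k)).

Definition gph (F : V -> V -> Prop) : set (V * V) := [set z | F z.1 z.2].
Definition coderiv (F : V -> V -> Prop) (x y vs us : V) : Prop :=
  lim_normal (gph F) (x, y) (us, - vs).
Definition dir_coderiv (F : V -> V -> Prop) (x y u v vs us : V) : Prop :=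
  dir_normal (gph F) (x, y) (u, v) (us, - vs).
Definition semismooth_star (F : V -> V -> Prop) (x y : V) : Prop :=
  forall u v vs us, dir_coderiv F x y u v vs us -> dotv us u = dotv vs v.

Definition newton_G (gamma : R) (f : V -> V) (q : V -> \bar R) (x u : V)
    (G : 'M[R]_n) : Prop :=
  G^T = G /\ (forall v, 0 <= dotv v (G *m v)) /\ (forall v, nrm (G *m v) <= nrm v) /\
  forall vs, coderiv (subdiff q) (x + u) (- (gamma *: u) - f x)
                     ((1%:M - G) *m vs) (G *m vs).
Definition newton_dir (gamma : R) (f : V -> V) (J : V -> 'M[R]_n) (q : V -> \bar R)
    (x u : V) (G : 'M[R]_n) (dx : V) : Prop :=
  newton_G gamma f q x u G /\
  ((1%:M - G) *m J x + G) *m dx = (gamma *: (1%:M - G) + G) *m u.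

Definition ls_cond (gamma nu xi : R) (beta : nat -> R) (f : V -> V) (q : V -> \bar R)
    (x1 dx u0 u1 : V) (j : nat) : Prop :=
  nrm (u_gamma gamma f q (x1 + beta j *: dx))
    <= (1 - nu * beta j) * (xi * nrm u0 + (1 - xi) * nrm u1).

Definition beta_ok (beta : nat -> R) : Prop :=
  beta 0%N = 1 /\ (forall j, 0 < beta j) /\ (forall j, beta j.+1 <= beta j) /\ cvgR beta 0.

Definition well_defined (gamma nu xi : R) (beta : nat -> R) (f : V -> V)
    (J : V -> 'M[R]_n) (q : V -> \bar R) : Prop :=
  (forall x, exists u, is_u_gamma gamma f q x u /\
                       forall u', is_u_gamma gamma f q x u' -> u' = u) /\
  (forall x, exists y, DR_rel gamma^-1 f q x y /\
                       forall y', DR_rel gamma^-1 f q x y' -> y' = y) /\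
  (forall x, exists G, newton_G gamma f q x (u_gamma gamma f q x) G) /\
  (forall x G, newton_G gamma f q x (u_gamma gamma f q x) G ->
     ((1%:M - G) *m J x + G) \in unitmx) /\
  (forall x0 x1 G dx, DR_rel gamma^-1 f q x0 x1 ->
     newton_dir gamma f J q x1 (u_gamma gamma f q x1) G dx ->
     exists j, ls_cond gamma nu xi beta f q x1 dx
                 (u_gamma gamma f q x0) (u_gamma gamma f q x1) j).

(* ---------- infinite runs of the algorithm (no stopping test) ---------- *)
Definition alg_run (gamma nu xi : R) (beta : nat -> R) (f : V -> V)
    (J : V -> 'M[R]_n) (q : V -> \bar R) (x : nat -> V) : Prop :=
  forall k : nat,
    DR_rel gamma^-1 f q (x k.*2) (x k.*2.+1) /\
    exists G dx j,
      newton_dir gamma f J q (x k.*2.+1) (u_gamma gamma f q (x k.*2.+1)) G dx /\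
      ls_cond gamma nu xi beta f q (x k.*2.+1) dx
              (u_gamma gamma f q (x k.*2)) (u_gamma gamma f q (x k.*2.+1)) j /\
      (forall i, (i < j)%N -> ~ ls_cond gamma nu xi beta f q (x k.*2.+1) dx
              (u_gamma gamma f q (x k.*2)) (u_gamma gamma f q (x k.*2.+1)) i) /\
      x k.*2.+2 = x k.*2.+1 + beta j *: dx.

Definition Q_linear_to0 (a : nat -> V) : Prop :=
  exists c : R, 0 <= c < 1 /\ exists K, forall k, (K <= k)%N -> nrm (a k.+1) <= c * nrm (a k).
Definition R_linear (a : nat -> V) (l : V) : Prop :=
  exists (C c : R), 0 <= C /\ 0 <= c < 1 /\ forall k, nrm (a k - l) <= C * c ^+ k.
Definition Q_superlinear (a : nat -> V) (l : V) : Prop :=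
  cvgV a l /\ forall e : R, 0 < e -> exists K, forall k, (K <= k)%N ->
    nrm (a k.+1 - l) <= e * nrm (a k - l).

End Defs.

(* Main.v *)
(** Writing [u x] for [u_gamma x], the inclusion [- gamma u - f x \in \partial q (x + u)] and the
    monotonicity of [\partial q] give everything except the existence of the Newton matrix [G] and the
    superlinear rate.  A Douglas-Rachford step [x |-> y] satisfies
    [|u y|^2 <= <u y, u x> - (mu / gamma) |y - x|^2], so it shrinks [|u|], by a fixed factor where
    [f] is Lipschitz; and [mu |x - y| <= (gamma + L) |u x - u y|] turns the linear decay of [u] along the
    iterates into R-linear convergence.

    Existence of [G].  Let [P = (I + \partial q)^-1], a nonexpansive map with a convex potential.
    Instead of Rademacher's theorem, consider the class of all blow-up limits of [P] at a point; it is
    closed under recentring, rescaling and pointwise limits.  A member of maximal slope in a direction [e],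
    blown up at the middle of an extremal chord and translated to infinity along [e], becomes affine in
    the direction [e] (here the potential enters).  Iterating over the coordinates yields a linear member
    [B], symmetric with [0 <= B <= I].  Thus [P] is almost affine with slope [B] on some arbitrarily small
    balls, and for each [v] minimising a quadratic perturbation of [- <v, P>] over such a ball produces
    regular normals to the graph of [\partial q] close to [((I - B) v, - B v)]; hence [G = I - B].

    Superlinear rate.  A compactness argument turns the directional definition of semismoothness* into a
    uniform estimate for regular normals of [H] near [(xbar, 0)], which transfers to [\partial q] and gives
    [((I - G) J x + G) (x + dx - xbar) = o (|x - xbar|)].  The system matrices are uniformly invertible,
    and the full step [1] is eventually accepted. *)
Require Import Defs.
From HB Require Import structures.
From mathcomp Require Import all_boot all_order all_algebra.
From mathcomp Require Import boolp classical_sets reals constructive_ereal ereal.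
From mathcomp Require Import filter ring lra.
Import Order.TTheory GRing.Theory Num.Theory.
Local Open Scope ring_scope.

Set Implicit Arguments.
Unset Strict Implicit.
Unset Printing Implicit Defensive.


(** * Euclidean geometry of column vectors *)

Ltac vring := apply/matrixP => ? ?; rewrite !mxE; ring.

Section Euclid.
Context {R : realType} {n : nat}.
Local Notation V := 'cV[R]_n.
Implicit Types (u v w : V) (a t : R) (A : 'M[R]_n).

Lemma dotvC u v : dotv u v = dotv v u.
Proof. by apply: eq_bigr => i _; rewrite mulrC. Qed.
Lemma dotvDl u v w : dotv (u + v) w = dotv u w + dotv v w.
Proof. by rewrite -big_split; apply: eq_bigr => i _; rewrite mxE mulrDl. Qed.
Lemma dotvZl a u v : dotv (a *: u) v = a * dotv u v.
Proof. by rewrite mulr_sumr; apply: eq_bigr => i _; rewrite mxE mulrA. Qed.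
Lemma dotvNl u v : dotv (- u) v = - dotv u v.
Proof. by rewrite -scaleN1r dotvZl mulN1r. Qed.
Lemma dotvBl u v w : dotv (u - v) w = dotv u w - dotv v w.
Proof. by rewrite dotvDl dotvNl. Qed.
Lemma dotvDr u v w : dotv w (u + v) = dotv w u + dotv w v.
Proof. by rewrite dotvC dotvDl ![dotv w _]dotvC. Qed.
Lemma dotvZr a u v : dotv u (a *: v) = a * dotv u v.
Proof. by rewrite dotvC dotvZl dotvC. Qed.
Lemma dotvNr u v : dotv u (- v) = - dotv u v.
Proof. by rewrite dotvC dotvNl dotvC. Qed.
Lemma dotvBr u v w : dotv w (u - v) = dotv w u - dotv w v.
Proof. by rewrite dotvDr dotvNr. Qed.
Lemma dotv0l u : dotv 0 u = 0.
Proof. by rewrite -(scale0r 0) dotvZl mul0r. Qed.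
Lemma dotv0r u : dotv u 0 = 0.
Proof. by rewrite dotvC dotv0l. Qed.
Definition dotvE := (dotvDl, dotvDr, dotvNl, dotvNr, dotvZl, dotvZr, dotv0l, dotv0r).

Lemma dotv_ge0 u : 0 <= dotv u u.
Proof. by apply: sumr_ge0 => i _; rewrite -expr2 sqr_ge0. Qed.
Lemma dotv_eq0 u : dotv u u = 0 -> u = 0.
Proof.
move=> /eqP; rewrite psumr_eq0; last by move=> i _; rewrite -expr2 sqr_ge0.
move=> /allP h; apply/matrixP => i j; rewrite ord1 mxE.
by have := h i (mem_index_enum i); rewrite mulf_eq0 orbb => /eqP.
Qed.
Lemma nrm_ge0 u : 0 <= nrm u. Proof. exact: sqrtr_ge0. Qed.
Lemma nrm_sqr u : nrm u ^+ 2 = dotv u u.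
Proof. by rewrite sqr_sqrtr // dotv_ge0. Qed.
Lemma nrm_eq0 u : nrm u = 0 -> u = 0.
Proof. by move=> h; apply: dotv_eq0; rewrite -nrm_sqr h expr0n. Qed.
Lemma nrm0 : nrm (0 : V) = 0.
Proof. by rewrite /nrm dotv0l sqrtr0. Qed.
Lemma nrm_gt0 u : u <> 0 -> 0 < nrm u.
Proof.
move=> h; rewrite lt_neqAle nrm_ge0 andbT eq_sym; apply/eqP => /nrm_eq0; exact: h.
Qed.
Lemma nrmN u : nrm (- u) = nrm u.
Proof. by rewrite /nrm !dotvE opprK. Qed.
Lemma nrmBC u v : nrm (u - v) = nrm (v - u).
Proof. by rewrite -nrmN opprB. Qed.
Lemma nrmZ a u : nrm (a *: u) = `|a| * nrm u.
Proof. by rewrite /nrm !dotvE mulrA -expr2 sqrtrM ?sqr_ge0 // sqrtr_sqr. Qed.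
Lemma nrmZp a u : 0 <= a -> nrm (a *: u) = a * nrm u.
Proof. by move=> h; rewrite nrmZ ger0_norm. Qed.

Lemma nrm_le a u : 0 <= a -> dotv u u <= a ^+ 2 -> nrm u <= a.
Proof.
by move=> a0 h; rewrite -(ler_pXn2r (_ : 0 < 2)%N) ?nnegrE ?nrm_ge0 // nrm_sqr.
Qed.
Lemma nrm_le2 u v : dotv u u <= dotv v v -> nrm u <= nrm v.
Proof. by move=> h; apply: nrm_le; rewrite ?nrm_ge0 ?nrm_sqr. Qed.

Lemma cauchy_schwarz u v : dotv u v <= nrm u * nrm v.
Proof.
have [->|u0] := pselect (u = 0); first by rewrite dotv0l nrm0 mul0r.
have [->|v0] := pselect (v = 0); first by rewrite dotv0r nrm0 mulr0.
have := dotv_ge0 (nrm v *: u - nrm u *: v).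
rewrite !dotvE (dotvC v u) -!nrm_sqr.
have := nrm_gt0 u0; have := nrm_gt0 v0.
move: (nrm u) (nrm v) (dotv u v) => a b c b0 a0 h.
have : 0 <= (a * b) * (a * b - c) by lra.
by rewrite pmulr_rge0 ?mulr_gt0 // subr_ge0.
Qed.
Lemma cauchy_schwarzN u v : - (nrm u * nrm v) <= dotv u v.
Proof. by rewrite lerNl -dotvNl -(nrmN u) cauchy_schwarz. Qed.
Lemma cauchy_schwarz_abs u v : `|dotv u v| <= nrm u * nrm v.
Proof. by rewrite ler_norml cauchy_schwarz cauchy_schwarzN. Qed.

Lemma nrmD u v : nrm (u + v) <= nrm u + nrm v.
Proof.
apply: nrm_le; first by rewrite addr_ge0 ?nrm_ge0.
rewrite !dotvE (dotvC v u) -!nrm_sqr; have := cauchy_schwarz u v; lra.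
Qed.
Lemma nrmB u v : nrm (u - v) <= nrm u + nrm v.
Proof. by rewrite -(nrmN v) nrmD. Qed.
Lemma nrm_tri u v w : nrm (u - w) <= nrm (u - v) + nrm (v - w).
Proof. by have := nrmD (u - v) (v - w); rewrite subrKA. Qed.
Lemma nrm_diff u v : `|nrm u - nrm v| <= nrm (u - v).
Proof.
rewrite ler_norml; have := nrmD (u - v) v; have := nrmB u (u - v).
rewrite subrK subKr; lra.
Qed.

Lemma dotv_ext u v : (forall w, dotv u w = dotv v w) -> u = v.
Proof.
move=> h; apply/eqP; rewrite -subr_eq0; apply/eqP/dotv_eq0.
by rewrite dotvBl h subrr.
Qed.

(** Testing with [w = u / 2] gives [|u|^2 / 2 <= |u|^2 / 4]. This is the device by which linear maps
    are identified below: a linear functional dominated by a quadratic is zero. *)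
Lemma dotv_le0_eq0 u : (forall w, dotv u w <= dotv w w) -> u = 0.
Proof.
move=> h; apply: dotv_eq0; apply/eqP; rewrite eq_le dotv_ge0 andbT.
have := h (2^-1 *: u); rewrite !dotvE; have := dotv_ge0 u; lra.
Qed.

Lemma coord_le_nrm u i : `|u i ord0| <= nrm u.
Proof.
rewrite -(ler_pXn2r (_ : 0 < 2)%N) ?nnegrE ?nrm_ge0 // nrm_sqr real_normK ?num_real //.
rewrite /dotv (bigD1 i) //= -expr2 lerDl; apply: sumr_ge0 => j _.
by rewrite -expr2 sqr_ge0.
Qed.
Lemma nrm_delta (i : 'I_n) : nrm (delta_mx i 0 : V) = 1.
Proof.
rewrite /nrm /dotv (bigD1 i) //= big1 ?addr0 ?mxE ?eqxx ?mulr1 ?sqrtr1 //.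
by move=> j /negPf ji; rewrite !mxE ji mul0r.
Qed.
Lemma dotv_delta (i : 'I_n) u : dotv u (delta_mx i 0) = u i 0.
Proof.
rewrite /dotv (bigD1 i) //= big1 ?addr0 ?mxE ?eqxx ?mulr1 //.
by move=> j /negPf ji; rewrite !mxE ji mulr0.
Qed.
Lemma vec_sum u : u = \sum_i u i 0 *: (delta_mx i 0 : V).
Proof.
rewrite {1}[u]matrix_sum_delta; apply: eq_bigr => i _; by rewrite big_ord1.
Qed.
Lemma nrm_sum (I : Type) (r : seq I) (F : I -> V) :
  nrm (\sum_(i <- r) F i) <= \sum_(i <- r) nrm (F i).
Proof.
apply: (big_ind2 (fun (x : V) y => nrm x <= y)) => //; first by rewrite nrm0.
move=> x1 x2 y1 y2 h1 h2; apply: le_trans (nrmD _ _) _; exact: lerD.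
Qed.
Lemma nrm_le_sum u : nrm u <= \sum_i `|u i 0|.
Proof.
rewrite {1}(vec_sum u); apply: le_trans (nrm_sum _ _) _.
by apply: ler_sum => i _; rewrite nrmZ nrm_delta mulr1.
Qed.

Lemma dotv_mulmx A u v : dotv (A *m u) v = dotv u (A^T *m v).
Proof.
have E (x y : V) : dotv x y = (x^T *m y) ord0 ord0.
  by rewrite mxE; apply: eq_bigr => i _; rewrite mxE.
by rewrite !E trmx_mul mulmxA.
Qed.

Definition mxnorm1 A : R := \sum_i \sum_j `|A i j|.
Lemma mxnorm1_ge0 A : 0 <= mxnorm1 A.
Proof. by apply: sumr_ge0 => i _; apply: sumr_ge0. Qed.
Lemma nrm_mulmx A u : nrm (A *m u) <= mxnorm1 A * nrm u.
Proof.
apply: le_trans (nrm_le_sum _) _; rewrite mulr_suml; apply: ler_sum => i _.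
rewrite mxE mulr_suml; apply: le_trans (ler_norm_sum _ _ _) _.
by apply: ler_sum => j _; rewrite normrM ler_wpM2l // coord_le_nrm.
Qed.
Lemma mxnorm1_le A a : (forall i j, `|A i j| <= a) -> mxnorm1 A <= n%:R * n%:R * a.
Proof.
move=> h; have : mxnorm1 A <= \sum_(i < n) \sum_(j < n) a.
  by apply: ler_sum => i _; apply: ler_sum => j _.
by rewrite !sumr_const card_ord -(mulr_natl (a *+ n)) -(mulr_natl a) mulrA.
Qed.

(** In operator terms [A^2 <= A]. Positivity at [u - A u] gives
    [2 |A u|^2 <= <u, A u> + <A (A u), A u>], and contractivity bounds the last term by
    [|A u|^2]. *)
Lemma psd_sqr_le A u : A^T = A -> (forall v, 0 <= dotv v (A *m v)) ->
  (forall v, nrm (A *m v) <= nrm v) -> dotv (A *m u) (A *m u) <= dotv (A *m u) u.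
Proof.
move=> sA pA cA; have := pA (u - A *m u); rewrite mulmxBr !dotvE.
rewrite (dotvC (A *m u) (A *m (A *m u))).
have := cauchy_schwarz (A *m (A *m u)) (A *m u); have := cA (A *m u).
have e : dotv (A *m (A *m u)) u = dotv (A *m u) (A *m u) by rewrite dotv_mulmx sA.
rewrite [dotv u (A *m (A *m u))]dotvC e (dotvC u) => h1 h2 h3.
have : nrm (A *m (A *m u)) * nrm (A *m u) <= nrm (A *m u) * nrm (A *m u).
  by rewrite ler_wpM2r ?nrm_ge0.
rewrite -expr2 nrm_sqr; nra.
Qed.

Lemma psd_compl_contraction A u : A^T = A -> (forall v, 0 <= dotv v (A *m v)) ->
  (forall v, nrm (A *m v) <= nrm v) -> nrm ((1%:M - A) *m u) <= nrm u.
Proof.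
move=> sA pA cA; apply: nrm_le2; rewrite mulmxBl mul1mx !dotvE.
have := psd_sqr_le u sA pA cA; have := pA u; rewrite (dotvC u (A *m u)).
have := dotv_ge0 (A *m u); lra.
Qed.

Lemma unitmx_of_ker A : (forall u, A *m u = 0 -> u = 0) -> A \in unitmx.
Proof.
move=> h; rewrite -unitmx_tr -row_free_unit -kermx_eq0.
apply/eqP/row_matrixP => i; rewrite row0; apply: (can_inj (@trmxK _ _ _)).
rewrite trmx0; apply: h.
by rewrite -{1}[A]trmxK -trmx_mul -row_mul mulmx_ker row0 trmx0.
Qed.

End Euclid.


(** * Limits along a free ultrafilter *)

Lemma free_ultrafilter :
  exists U : set_system nat, UltraFilter U /\ (\oo `<=` U)%classic.
Proof. exact: ultraFilterLemma. Qed.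

(* All compactness arguments take limits along one fixed free ultrafilter on nat. *)
Definition hyper : set_system nat := projT1 (cid free_ultrafilter).

Definition unear (P : nat -> Prop) : Prop := hyper P.

#[local] Instance hyper_ultra : UltraFilter hyper.
Proof. by rewrite /hyper; case: cid => U []. Qed.

Lemma unear_eventually (P : nat -> Prop) K : (forall k, (K <= k)%N -> P k) -> unear P.
Proof.
move=> h; rewrite /unear /hyper; case: cid => U /= [uU]; apply.
by exists K => // k /= /h.
Qed.
Lemma unear_and (P Q : nat -> Prop) : unear P -> unear Q -> unear (fun k => P k /\ Q k).
Proof. exact: filterI. Qed.
Lemma unear_mono (P Q : nat -> Prop) : (forall k, P k -> Q k) -> unear P -> unear Q.
Proof. exact: filterS. Qed.
Lemma unear_ex (P : nat -> Prop) : unear P -> exists k, P k.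
Proof. exact: (@filter_ex _ hyper). Qed.
Lemma unear_ex_ge (P : nat -> Prop) K : unear P -> exists2 k, (K <= k)%N & P k.
Proof.
move=> h; have [] := @unear_ex (fun k => (K <= k)%N /\ P k); last by move=> k [? ?]; exists k.
by apply: unear_and => //; apply: (@unear_eventually _ K).
Qed.
Lemma unear_em (P : nat -> Prop) : unear P \/ unear (fun k => ~ P k).
Proof. exact: (@in_ultra_setVsetC _ hyper P). Qed.

Section Ulim.
Context {R : realType}.

Lemma ex_nat_gt (x : R) : exists K : nat, x < K%:R.
Proof.
exists (Num.bound `|x|); apply: le_lt_trans (ler_norm x) _.
exact/archi_boundP/normr_ge0.
Qed.

Definition ucvg (s : nat -> R) (l : R) :=
  forall e : R, 0 < e -> unear (fun k => `|s k - l| < e).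

(** The limit is the supremum of the [r] that lie below [s] on a set of the ultrafilter; the
    dichotomy [unear_em] supplies the upper estimate. *)
Lemma ucvg_bounded (s : nat -> R) M : (forall k, `|s k| <= M) -> exists l, ucvg s l.
Proof.
move=> sM.
pose E := [set r : R | unear (fun k => r <= s k)]%classic.
have supE : has_sup E.
  split; first by exists (- M); apply: (@unear_eventually _ 0) => k _; have := sM k; rewrite ler_norml => /andP[].
  exists M => r /unear_ex [k rk]; apply: le_trans rk _.
  by have := sM k; rewrite ler_norml => /andP[].
exists (sup E) => e e0.
have h1 : unear (fun k => sup E - e < s k).
  have [r Er lr] := sup_adherent e0 supE.
  by move: Er; apply: unear_mono => k; apply: lt_le_trans.
have h2 : unear (fun k => s k < sup E + e).
  case: (unear_em (fun k => s k < sup E + e)) => // h.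
  have : E (sup E + e) by move: h; apply: unear_mono => k /negP; rewrite -leNgt.
  move=> /(ub_le_sup (proj2 supE)); rewrite gerDl leNgt e0 //.
by apply: unear_mono (unear_and h1 h2) => k [? ?]; rewrite ltr_distl; apply/andP.
Qed.

Lemma ucvg_cst l : ucvg (fun=> l) l.
Proof. by move=> e e0; apply: (@unear_eventually _ 0) => k _; rewrite subrr normr0. Qed.
Lemma ucvgD s t l m : ucvg s l -> ucvg t m -> ucvg (fun k => s k + t k) (l + m).
Proof.
move=> hs ht e e0; have e2 : 0 < e / 2 by lra.
apply: unear_mono (unear_and (hs _ e2) (ht _ e2)) => k []; rewrite !ltr_norml; lra.
Qed.
Lemma ucvgZ c s l : ucvg s l -> ucvg (fun k => c * s k) (c * l).
Proof.
move=> h e e0; have c1 : 0 < `|c| + 1 by have := normr_ge0 c; lra.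
apply: unear_mono (h _ (divr_gt0 e0 c1)) => k hk; rewrite -mulrBr normrM.
have : (`|c| + 1) * `|s k - l| < e by rewrite mulrC -ltr_pdivlMr.
have := normr_ge0 (s k - l); have := normr_ge0 c; nra.
Qed.
Lemma ucvgN s l : ucvg s l -> ucvg (fun k => - s k) (- l).
Proof. by move=> h e /h; apply: unear_mono => k; rewrite -opprD normrN. Qed.
Lemma ucvgB s t l m : ucvg s l -> ucvg t m -> ucvg (fun k => s k - t k) (l - m).
Proof. by move=> hs ht; apply: ucvgD => //; apply: ucvgN. Qed.
Lemma ucvg_le s t l m : ucvg s l -> ucvg t m -> unear (fun k => s k <= t k) -> l <= m.
Proof.
move=> hs ht h; rewrite leNgt; apply/negP => ml; have e0 : 0 < (l - m) / 2 by lra.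
have [k []] := unear_ex (unear_and h (unear_and (hs _ e0) (ht _ e0))) => hk [].
rewrite !ltr_norml; lra.
Qed.
Lemma ucvg_uniq s l m : ucvg s l -> ucvg s m -> l = m.
Proof.
move=> h1 h2; apply/eqP; rewrite eq_le.
by apply/andP; split; apply: ucvg_le; eauto; apply: (@unear_eventually _ 0) => k _.
Qed.
Lemma ucvg_inv : ucvg (fun k => k.+1%:R^-1) 0.
Proof.
move=> e e0; have [K hK] := ex_nat_gt e^-1.
apply: (@unear_eventually _ K) => k Kk; rewrite subr0 ger0_norm ?invr_ge0 //.
rewrite invf_plt ?posrE //; apply: lt_trans hK _; by rewrite ltr_nat ltnS.
Qed.
(** By polarisation it is enough to treat squares. *)
Lemma ucvgM s t l m : ucvg s l -> ucvg t m -> ucvg (fun k => s k * t k) (l * m).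
Proof.
move=> hs ht.
have sq (a : nat -> R) b : ucvg a b -> ucvg (fun k => a k * a k) (b * b).
  move=> ha e e0.
  have d0 : 0 < Num.min 1 (e / (2 * `|b| + 2)).
    by rewrite lt_min ltr01 divr_gt0 //; have := normr_ge0 b; lra.
  apply: unear_mono (ha _ d0) => k; rewrite lt_min => /andP[h1].
  rewrite ltr_pdivlMr; last by have := normr_ge0 b; lra.
  move=> h2; have -> : a k * a k - b * b = (a k - b) * (a k + b) by ring.
  rewrite normrM; apply: le_lt_trans h2; rewrite ler_wpM2l //.
  have -> : a k + b = (a k - b) + 2 * b by ring.
  apply: le_trans (ler_normD _ _) _; rewrite normrM normr_nat; lra.
have := ucvgZ (4^-1) (ucvgB (sq _ _ (ucvgD hs ht)) (sq _ _ (ucvgB hs ht))).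
have E x y : 4^-1 * ((x + y) * (x + y) - (x - y) * (x - y)) = x * y :> R by field.
by rewrite E; congr ucvg; apply/funext => k; rewrite E.
Qed.

(** * Ultralimits of vectors and attainment of minima *)

Context {n : nat}.
Local Notation V := 'cV[R]_n.
Definition ucvgV (s : nat -> V) (l : V) :=
  forall e : R, 0 < e -> unear (fun k => nrm (s k - l) < e).

Lemma ucvgV_nrm s l : ucvgV s l <-> ucvg (fun k => nrm (s k - l)) 0.
Proof. by split=> h e /h; apply: unear_mono => k; rewrite subr0 ger0_norm ?nrm_ge0. Qed.
Lemma ucvgV_coord (s : nat -> V) (l : V) : (forall i, ucvg (fun k => s k i ord0) (l i ord0)) -> ucvgV s l.
Proof.
move=> h e e0; have e1 : 0 < e / n.+1%:R by rewrite divr_gt0 ?ltr0Sn.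
have : unear (fun k => forall i : 'I_n, `|s k i ord0 - l i ord0| < e / n.+1%:R).
  have : forall r : seq 'I_n, unear (fun k => forall i : 'I_n, i \in r -> `|s k i ord0 - l i ord0| < e / n.+1%:R).
    elim=> [|a r IH]; first exact: (@unear_eventually _ 0).
    apply: unear_mono (unear_and IH (h a _ e1)) => k [h1 h2] i.
    by rewrite in_cons => /orP[/eqP ->//|]; apply: h1.
  by move=> /(_ (index_enum 'I_n)); apply: unear_mono => k hk i; apply: hk; rewrite mem_index_enum.
apply: unear_mono => k hk; apply: le_lt_trans (nrm_le_sum _) _.
apply: (@le_lt_trans _ _ (\sum_(i < n) e / n.+1%:R)).
  by apply: ler_sum => i _; rewrite !mxE; apply/ltW/hk.
rewrite sumr_const card_ord -(mulr_natl (e / _)) mulrCA gtr_pMr //.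
by rewrite ltr_pdivrMr ?ltr0Sn // mul1r ltr_nat.
Qed.
Lemma ucvgV_bounded (s : nat -> V) M : (forall k, nrm (s k) <= M) -> exists l, ucvgV s l.
Proof.
move=> h; have h1 (i : 'I_n) : exists l, ucvg (fun k => s k i ord0) l.
  by apply: (@ucvg_bounded _ M) => k; apply: le_trans (coord_le_nrm _ _) (h k).
have [l hl] := choice h1.
by exists (\col_i l i); apply: ucvgV_coord => i; rewrite mxE; apply: hl.
Qed.
Lemma ucvgV_cst l : ucvgV (fun=> l) l.
Proof. by move=> e e0; apply: (@unear_eventually _ 0) => k _; rewrite subrr nrm0. Qed.
Lemma ucvgV_bound (a : nat -> R) (s : nat -> V) l :
  ucvg a 0 -> unear (fun k => nrm (s k - l) <= a k) -> ucvgV s l.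
Proof.
move=> h ha e /h h'; apply: unear_mono (unear_and h' ha) => k []; rewrite subr0 => h1 h2.
by apply: le_lt_trans h1; apply: le_trans h2 (ler_norm _).
Qed.
Lemma ucvgVD s t l m : ucvgV s l -> ucvgV t m -> ucvgV (fun k => s k + t k) (l + m).
Proof.
move=> /ucvgV_nrm h1 /ucvgV_nrm h2; apply: (ucvgV_bound (a := fun k => nrm (s k - l) + nrm (t k - m))).
  by rewrite -[0](addr0 0); apply: ucvgD.
by apply: (@unear_eventually _ 0) => k _; rewrite opprD addrACA nrmD.
Qed.
Lemma ucvgVZ c s l : ucvgV s l -> ucvgV (fun k => c *: s k) (c *: l).
Proof.
move=> /ucvgV_nrm /(ucvgZ `|c|); rewrite mulr0 => h; apply: (ucvgV_bound h).
by apply: (@unear_eventually _ 0) => k _; rewrite -scalerBr nrmZ.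
Qed.
Lemma ucvgVN s l : ucvgV s l -> ucvgV (fun k => - s k) (- l).
Proof. by move=> h e /h; apply: unear_mono => k; rewrite -opprD nrmN. Qed.
Lemma ucvgVB s t l m : ucvgV s l -> ucvgV t m -> ucvgV (fun k => s k - t k) (l - m).
Proof. by move=> hs ht; apply: ucvgVD => //; apply: ucvgVN. Qed.
Lemma ucvg_nrm s l : ucvgV s l -> ucvg (fun k => nrm (s k)) (nrm l).
Proof. by move=> h e /h; apply: unear_mono => k; apply: le_lt_trans; apply: nrm_diff. Qed.
Lemma ucvg_dot s t l m : ucvgV s l -> ucvgV t m -> ucvg (fun k => dotv (s k) (t k)) (dotv l m).
Proof.
move=> hs ht.
have E u v : dotv u v = (nrm (u + v) * nrm (u + v) - nrm (u - v) * nrm (u - v)) / 4 :> R.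
  by rewrite -!expr2 !nrm_sqr !dotvE (dotvC v u); field.
have nD := ucvg_nrm (ucvgVD hs ht); have nB := ucvg_nrm (ucvgVB hs ht).
have := ucvgZ (4^-1) (ucvgB (ucvgM nD nD) (ucvgM nB nB)).
rewrite mulrC -E; congr ucvg; apply/funext => k; by rewrite mulrC -E.
Qed.
Lemma ucvgV_uniq s l m : ucvgV s l -> ucvgV s m -> l = m.
Proof.
move=> h1 h2; apply: dotv_ext => w.
by apply: ucvg_uniq (ucvg_dot h1 (ucvgV_cst w)) (ucvg_dot h2 (ucvgV_cst w)).
Qed.

(** The direct method. The values of a minimising sequence are taken within [1 / (k + 1) <= 1] of
    the infimum, so boundedness is asked only on the sublevel set of [F x0 + 1]. The last premise
    combines closedness of [A] with lower semicontinuity of [F], tested on sequences whose values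
    converge as well. *)
Lemma attains_min (A : V -> Prop) (F : V -> R) x0 m M : A x0 ->
  (forall x, A x -> m <= F x) ->
  (forall x, A x -> F x <= F x0 + 1 -> nrm x <= M) ->
  (forall s l c, (forall k, A (s k)) -> ucvgV s l -> ucvg (F \o s) c -> A l /\ F l <= c) ->
  exists x, A x /\ forall y, A y -> F x <= F y.
Proof.
move=> A0 hm hM hl.
pose E := [set r | exists2 x, A x & r = F x]%classic.
have iE : has_inf E by split; [exists (F x0), x0|exists m => _ [x Ax ->]; apply: hm].
have hk k : exists x, A x /\ F x < inf E + k.+1%:R^-1.
  have k0 : 0 < k.+1%:R^-1 :> R by rewrite invr_gt0 ltr0Sn.
  by have [_ [x Ax ->] h] := inf_adherent k0 iE; exists x.
have [s hs] := choice hk.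
have infl x : A x -> inf E <= F x by move=> Ax; apply: ge_inf; [case: iE|exists x].
have [l sl] : exists l, ucvgV s l.
  apply: (@ucvgV_bounded _ M) => k; have [As Fs] := hs k; apply: hM => //.
  apply: le_trans (ltW Fs) _; rewrite lerD ?infl //.
  by rewrite invf_le1 ?ltr0Sn // ler1n.
have [|||Al Fl] := hl s l (inf E) => //; first by move=> k; case: (hs k).
  move=> e /ucvg_inv; apply: unear_mono => k; rewrite subr0 => /(le_lt_trans (ler_norm _)) h.
  have [As Fs] := hs k; have iF := infl _ As; rewrite /= ltr_distl.
  apply/andP; split; first by apply: lt_le_trans iF; rewrite gtrDl oppr_lt0; apply: le_lt_trans h; rewrite invr_ge0.
  by apply: lt_trans Fs _; rewrite ltrD2l.
by exists l; split=> // y Ay; apply: le_trans Fl (infl _ Ay).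
Qed.
End Ulim.


(** * Blow-up classes *)

Section Blowup.
Context {R : realType}.

(** Splitting the interval at its midpoint halves the constant in the quadratic bound; after [k]
    bisections [|p a - p b| 2^k <= C (a - b)^2]. *)
Lemma sq_lipschitz_const (p : R -> R) (C : R) :
  (forall a b, `|p a - p b| <= C * (a - b) ^+ 2) -> forall a b, p a = p b.
Proof.
move=> h a b.
have hk k : forall a b, `|p a - p b| * 2 ^+ k <= C * (a - b) ^+ 2.
  elim: k => [|k IH] x y; first by rewrite expr0 mulr1.
  have h1 := IH x ((x + y) / 2); have h2 := IH ((x + y) / 2) y.
  have : `|p x - p y| <= `|p x - p ((x + y) / 2)| + `|p ((x + y) / 2) - p y|.
    by apply: le_trans (ler_normD _ _); rewrite subrKA.
  have e : 0 <= 2 ^+ k :> R by rewrite exprn_ge0.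
  rewrite exprSr; set u := `|_ - p ((x + y) / 2)| in h1 *; set v := `|_ - p y| in h2 *.
  move=> h3; apply: le_trans (_ : (u + v) * (2 ^+ k * 2) <= _).
    by rewrite ler_wpM2r // mulr_ge0.
  apply: le_trans (_ : 2 * (u * 2 ^+ k + v * 2 ^+ k) <= _); first by lra.
  apply: le_trans (_ : 2 * (C * (x - (x + y) / 2) ^+ 2 + C * ((x + y) / 2 - y) ^+ 2) <= _).
    by rewrite ler_pM2l // lerD.
  by lra.
apply/eqP; rewrite -subr_eq0 -normr_le0 leNgt; apply/negP => d0.
have [K hK] := ex_nat_gt ((C * (a - b) ^+ 2) / `|p a - p b|).
move: hK; rewrite ltr_pdivrMr // ltNge => /negP; apply; apply: le_trans (hk K a b).
rewrite mulrC ler_pM2l // -natrX ler_nat; exact/ltnW/ltn_expl.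
Qed.

Context {n : nat}.
Local Notation V := 'cV[R]_n.
Implicit Types (g : V -> V) (K : (V -> V) -> Prop).

Definition nonexpansive g := forall x y, nrm (g x - g y) <= nrm (x - y).
(** The inequality makes [g] a selection of subgradients of a finite convex function [phi]; for
    continuous [g] this means that [g] is the gradient of [phi]. *)
Definition has_potential g :=
  exists phi : V -> R, forall x y, phi x + dotv (g x) (y - x) <= phi y.
Definition rescale g (x0 : V) (eps : R) : V -> V :=
  fun h => eps^-1 *: (g (x0 + eps *: h) - g x0).

(** In [bc_rescale] the scale [eps] is any positive number: small values zoom in, and [eps = 1] is
    pure recentring, which is used to translate a member to infinity. *)
Record blowup_class K : Prop := BlowupClass {
  bc_nonexpansive : forall g, K g -> nonexpansive g;
  bc_potential : forall g, K g -> has_potential g;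
  bc_at0 : forall g, K g -> g 0 = 0;
  bc_rescale : forall g x0 eps, 0 < eps -> K g -> K (rescale g x0 eps);
  bc_lim : forall (gk : nat -> V -> V) g, (forall k, K (gk k)) ->
    (forall x, ucvgV (gk^~ x) (g x)) -> K g }.
Arguments bc_rescale [K] _ [g] x0 [eps].

Lemma blowup_class_compact K (gk : nat -> V -> V) : blowup_class K -> (forall k, K (gk k)) ->
  exists g, K g /\ forall x, ucvgV (gk^~ x) (g x).
Proof.
move=> bK hk; have h x : exists l, ucvgV (gk^~ x) l.
  apply: (@ucvgV_bounded _ _ _ (nrm x)) => k.
  by have := bc_nonexpansive bK (hk k) x 0; rewrite (bc_at0 bK (hk k)) !subr0.
have [g hg] := choice h; exists g; split=> //; exact: bc_lim hk hg.
Qed.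

Lemma nonexpansive_bound g : nonexpansive g -> g 0 = 0 -> forall x, nrm (g x) <= nrm x.
Proof. by move=> ng g0 x; have := ng x 0; rewrite g0 !subr0. Qed.

(** * Members of maximal slope in a fixed direction *)

Section Direction.
Variables (K : (V -> V) -> Prop) (e : V).
Hypotheses (bK : blowup_class K) (K0 : exists g, K g) (e1 : nrm e = 1).

(** By compactness the supremum of the slopes on the chord from [0] to [e] is attained; rescaling by
    [t] at [x] carries the bound to every chord parallel to [e]. *)
Lemma max_slope_chord : exists s, (forall g (x : V) (t : R), K g -> 0 <= t ->
    dotv e (g (x + t *: e) - g x) <= s * t) /\
  exists g, K g /\ dotv e (g e) = s.
Proof.
pose E := [set r | exists2 g, K g & r = dotv e (g e)]%classic.
have supE : has_sup E.
  split; first by case: K0 => g Kg; exists (dotv e (g e)), g.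
  exists 1 => _ [g Kg ->]; apply: le_trans (cauchy_schwarz _ _) _; rewrite e1 mul1r -e1.
  exact: nonexpansive_bound (bc_nonexpansive bK Kg) (bc_at0 bK Kg) _.
have ub g : K g -> dotv e (g e) <= sup E.
  by move=> Kg; apply: ub_le_sup; [case: supE|exists g].
have hk k : exists g, K g /\ sup E - k.+1%:R^-1 < dotv e (g e).
  have k0 : 0 < k.+1%:R^-1 :> R by rewrite invr_gt0 ltr0Sn.
  by have [_ [g Kg ->] h] := sup_adherent k0 supE; exists g.
have [gk hgk] := choice hk.
have [g [Kg hg]] := blowup_class_compact bK (fun k => proj1 (hgk k)).
exists (sup E); split; last first.
  exists g; split=> //; apply/eqP; rewrite eq_le ub //=.
  have h2 := ucvg_dot (ucvgV_cst e) (hg e).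
  have := ucvgB (ucvg_cst (sup E)) (@ucvg_inv R); rewrite subr0 => h1.
  by apply: ucvg_le h1 h2 _; apply: (@unear_eventually _ 0) => k _; apply: ltW; case: (hgk k).
move=> h x t Kh; rewrite le_eqVlt => /orP[/eqP <-|t0].
  by rewrite scale0r addr0 subrr dotv0r mulr0.
have := ub _ (bc_rescale bK x t0 Kh); rewrite /rescale dotvZr.
by rewrite -ler_pdivlMl ?invr_gt0 // invrK mulrC.
Qed.

(** A chord of maximal total slope has maximal slope on each subinterval, since neither piece can
    compensate for a loss on the other. Zooming in at its midpoint stretches the chord to the whole
    line. *)
Lemma max_slope_line : exists s, (forall g (x : V) (t : R), K g -> 0 <= t ->
    dotv e (g (x + t *: e) - g x) <= s * t) /\
  exists g, K g /\ forall t, dotv e (g (t *: e)) = s * t.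
Proof.
have [s [hs [g0 [Kg0 h0]]]] := max_slope_chord; exists s; split=> //.
have seg t : 0 <= t <= 1 -> dotv e (g0 (t *: e)) = s * t.
  move=> /andP[t0 t1]; have := hs _ 0 t Kg0 t0.
  have := hs _ (t *: e) (1 - t) Kg0; rewrite -scalerDl (addrC t) subrK scale1r.
  rewrite add0r (bc_at0 bK Kg0) subr0 dotvDr dotvNr h0 subr_ge0 t1 => /(_ isT); lra.
pose d m : R := (2 * m.+1%:R)^-1.
have d0 m : 0 < d m by rewrite invr_gt0 mulr_gt0 ?ltr0Sn.
have dE m : d m * m.+1%:R = 2^-1.
  by rewrite /d invfM -mulrA mulVf ?mulr1.
have [g [Kg hg]] := blowup_class_compact bK (fun m => bc_rescale bK (2^-1 *: e) (d0 m) Kg0).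
exists g; split=> // t.
apply: ucvg_uniq (ucvg_dot (ucvgV_cst e) (hg (t *: e))) _ => eps eps0.
have [N hN] := ex_nat_gt `|t|.
apply: (@unear_eventually _ N) => m Nm; rewrite /rescale dotvZr dotvBr scalerA -scalerDl.
have tm : `|d m * t| <= 2^-1.
  rewrite normrM (gtr0_norm (d0 m)) -(dE m) ler_pM2l //.
  by apply: le_trans (ltW hN) _; rewrite ler_nat ltnW.
move: tm; rewrite ler_norml => /andP[tm1 tm2].
rewrite !seg; [|apply/andP; split; lra|apply/andP; split; lra].
rewrite -mulrBr [2^-1 + _]addrC addrK mulrCA mulKf ?subrr ?normr0 //; exact: lt0r_neq0.
Qed.

(* Translating towards infinity along [e] makes the extremal behaviour uniform in [x]. *)
Lemma max_slope_space : exists s, exists g, K g /\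
  forall x t, dotv e (g (x + t *: e)) = dotv e (g x) + s * t.
Proof.
have [s [hs [g1 [Kg1 h1]]]] := max_slope_line; exists s.
(* The deviation from slope [s] on the line through [x] is nonincreasing in [t], as [s] is the
   maximal slope, and bounded by [|x|], as [g1] is nonexpansive. Hence it has a limit at infinity
   that does not depend on the offset [t]. *)
pose a x t := dotv e (g1 (x + t *: e)) - s * t.
have adec x t t' : t <= t' -> a x t' <= a x t.
  move=> tt; have := hs _ (x + t *: e) (t' - t) Kg1.
  rewrite subr_ge0 tt => /(_ isT); rewrite -addrA -scalerDl (addrC t) subrK dotvBr /a; lra.
have abd x t : `|a x t| <= nrm x.
  rewrite /a -h1 -dotvBr; apply: le_trans (cauchy_schwarz_abs _ _) _; rewrite e1 mul1r.
  by apply: le_trans (bc_nonexpansive bK Kg1 _ _) _; rewrite addrK.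
have hA x : exists A, forall t, ucvg (fun m => a x (m%:R + t)) A.
  have [A hA] := ucvg_bounded (fun m => abd x m%:R); exists A.
  have lA t : A <= a x t.
    apply: ucvg_le hA (ucvg_cst (a x t)) _; have [N hN] := ex_nat_gt t.
    by apply: (@unear_eventually _ N) => m Nm; apply/adec/(le_trans (ltW hN)); rewrite ler_nat.
  move=> t eps eps0; have [m0 hm] := unear_ex (hA _ eps0).
  have [N hN] := ex_nat_gt (m0%:R - t).
  apply: (@unear_eventually _ N) => m Nm; rewrite ltr_norml; have := lA (m%:R + t).
  have : a x (m%:R + t) <= a x m0%:R.
    by apply: adec; rewrite -lerBlDr; apply: le_trans (ltW hN) _; rewrite ler_nat.
  by move: hm; rewrite ltr_norml; lra.
have [A hAA] := choice hA.
have [g [Kg hg]] := blowup_class_compact bK (fun m => bc_rescale bK (m%:R *: e) ltr01 Kg1).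
have key x t : dotv e (g (x + t *: e)) = A x + s * t.
  apply: ucvg_uniq (ucvg_dot (ucvgV_cst e) (hg (x + t *: e))) _.
  have := ucvgD (hAA x t) (ucvg_cst (s * t)); congr ucvg; apply/funext => m.
  rewrite /rescale invr1 !scale1r dotvBr h1 /a (addrC (m%:R *: e)) -[x + _ + _]addrA -scalerDl (addrC t).
  by ring.
exists g; split=> // x t; rewrite key; congr (_ + _).
by have := key x 0; rewrite scale0r addr0 mulr0 addr0.
Qed.

(** So far only the component of [g] along [e] is known to be affine in that direction; the
    potential upgrades this to the full vector. With [c x = <e, g x>] one finds that [c] is additive
    and equals [<g e, ->], and that [t * g e - (g (x + t e) - g x)] pairs with each [v] to at most
    [|v|^2], so it vanishes. *)
Lemma additive_along : exists b g, K g /\ forall x t, g (x + t *: e) = g x + t *: b.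
Proof.
have [s [g [Kg hc]]] := max_slope_space.
have [phi hphi] := bc_potential bK Kg; have ng := bc_nonexpansive bK Kg.
pose c x := dotv e (g x).
(* On the line the derivative of [phi] is [c x + s t]. After subtraction of the expected quadratic
   the remainder varies at most quadratically, hence is constant. *)
have phiE x t : phi (x + t *: e) = phi x + t * c x + s * t ^+ 2 / 2.
  pose p r := phi (x + r *: e) - r * c x - s * r ^+ 2 / 2.
  have hp a b : p a - p b <= `|s| / 2 * (a - b) ^+ 2.
    have := hphi (x + a *: e) (x + b *: e).
    have -> : x + b *: e - (x + a *: e) = (b - a) *: e.
      by rewrite opprD addrACA subrr add0r scalerBl.
    rewrite dotvZr dotvC hc -/(c x) /p => h.
    have : s * (a - b) ^+ 2 <= `|s| * (a - b) ^+ 2 by rewrite ler_wpM2r ?sqr_ge0 ?ler_norm.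
    lra.
  have := @sq_lipschitz_const p (`|s| / 2) _ t 0.
  rewrite /p scale0r addr0 => h; suff : forall a b, `|p a - p b| <= `|s| / 2 * (a - b) ^+ 2.
    by move=> /h; lra.
  move=> a b; rewrite ler_norml; have := hp a b; have := hp b a; lra.
(* By [phiE] this is the gap in the gradient inequality of [phi] from [x + t e] to [x + v + t e]. It
   is nonnegative, and at most [|v|^2] by the reverse inequality and nonexpansiveness, uniformly in
   [t]. *)
pose th x v t := t * (c (x + v) - c x) + phi (x + v) - phi x - dotv (g (x + t *: e)) v.
have hth x v t : 0 <= th x v t <= dotv v v.
  have dv : x + v + t *: e - (x + t *: e) = v.
    by rewrite opprD addrACA subrr addr0 addrAC subrr add0r.
  have := hphi (x + t *: e) (x + v + t *: e).
  have := hphi (x + v + t *: e) (x + t *: e).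
  have := cauchy_schwarz (g (x + v + t *: e) - g (x + t *: e)) v.
  have := ng (x + v + t *: e) (x + t *: e).
  rewrite -[x + t *: e - (x + v + t *: e)]opprB dv.
  have := nrm_sqr v; have := nrm_ge0 v.
  rewrite !phiE /th dotvNr dotvBl.
  set a := nrm (_ - _); set b := nrm v => b0 bb ab.
  have : a * b <= b * b by rewrite ler_wpM2r.
  rewrite -expr2 bb; lra.
(* [t] times the increment of [c] along [v] is bounded uniformly in [t] up to a term that is
   Lipschitz in the base point, so that the increment cannot depend on the base point. *)
have Dle x x' v : c (x + v) - c x <= c (x' + v) - c x'.
  rewrite leNgt; apply/negP => h.
  set D := c (x + v) - c x in h; set D' := c (x' + v) - c x' in h.
  pose M := nrm (x - x') * nrm v + `|(phi (x + v) - phi x) - (phi (x' + v) - phi x')| + dotv v v.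
  have hM t : t * (D - D') <= M.
    have := hth x v t; have := hth x' v t; rewrite /th -/D -/D'.
    have := cauchy_schwarz (g (x + t *: e) - g (x' + t *: e)) v; rewrite dotvBl.
    have : nrm (g (x + t *: e) - g (x' + t *: e)) * nrm v <= nrm (x - x') * nrm v.
      rewrite ler_wpM2r ?nrm_ge0 //; apply: le_trans (ng _ _) _.
      by rewrite opprD addrACA subrr addr0.
    rewrite /M; set ph := phi (x + v) - phi x - _.
    have := ler_norm (- ph); rewrite normrN /ph; lra.
  have [N hN] := ex_nat_gt (M / (D - D')).
  by move: hN; rewrite ltr_pdivrMr ?subr_gt0 // ltNge hM.
have cD x v : c (x + v) = c x + c v.
  have := Dle x 0 v; have := Dle 0 x v; rewrite add0r /c (bc_at0 bK Kg) dotv0r; lra.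
have hd x v t : `|t * c v - dotv (g (x + t *: e) - g x) v| <= dotv v v.
  have := hth x v t; have := hth x v 0; rewrite /th scale0r addr0 mul0r cD dotvBl ler_norml; lra.
have cE v : c v = dotv (g e) v.
  have cZ : forall a b, c (a *: v) - c (b *: v) = c ((a - b) *: v).
    by move=> a b; have := cD ((a - b) *: v) (b *: v); rewrite -scalerDl subrK => ->; rewrite addrK.
  pose p r := c (r *: v) - r * dotv (g e) v.
  have h1 : forall a b, `|p a - p b| <= dotv v v * (a - b) ^+ 2.
    move=> a b; have := hd 0 ((a - b) *: v) 1.
    rewrite scale1r add0r (bc_at0 bK Kg) subr0 mul1r -cZ !dotvZr dotvZl.
    have -> : p a - p b = c (a *: v) - c (b *: v) - (a - b) * dotv (g e) v.
      by rewrite /p; ring.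
    by move=> h; apply: le_trans h _; lra.
  have := sq_lipschitz_const h1 1 0.
  rewrite /p scale1r scale0r mul0r /c (bc_at0 bK Kg) dotv0r; lra.
exists (g e), g; split=> // x t.
have h : t *: g e - (g (x + t *: e) - g x) = 0.
  apply: dotv_le0_eq0 => v; rewrite dotvBl dotvZl -cE.
  exact: le_trans (ler_norm _) (hd x v t).
by move/eqP: h; rewrite subr_eq0 => /eqP ->; rewrite [RHS]addrC subrK.
Qed.
End Direction.

Definition additive_along_dir e b K g := K g /\ forall (x : V) (t : R), g (x + t *: e) = g x + t *: b.

(** Affinity along [e] with slope [b] survives recentring, rescaling and limits, so the extremal
    argument can be repeated inside the smaller class for the next direction. *)
Lemma blowup_class_additive K (e b : V) : blowup_class K -> blowup_class (additive_along_dir e b K).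
Proof.
move=> bK; split.
- by move=> g [Kg _]; apply: bc_nonexpansive Kg.
- by move=> g [Kg _]; apply: bc_potential Kg.
- by move=> g [Kg _]; apply: bc_at0 Kg.
- move=> g x0 eps eps0 [Kg hg]; split; first exact: bc_rescale.
  move=> x t; rewrite /rescale [eps *: (x + _)]scalerDr [x0 + _]addrA scalerA hg addrAC scalerDr scalerA mulrA.
  by rewrite mulVf ?mul1r //; apply: lt0r_neq0.
- move=> gk g hk hg; split; first by apply: bc_lim hg => // k; case: (hk k).
  move=> x t; apply: ucvgV_uniq (hg _) _.
  have <- : (fun k => gk k x + t *: b) = (fun k => gk k (x + t *: e)).
    by apply/funext => k; case: (hk k) => _ ->.
  exact: ucvgVD (hg x) (ucvgV_cst _).
Qed.

Lemma blowup_class_linear K : blowup_class K -> (exists g, K g) ->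
  exists B : 'M[R]_n, K (mulmx B).
Proof.
move=> bK K0.
have : forall r : seq 'I_n, exists K', blowup_class K' /\ (exists g, K' g) /\
    (forall g, K' g -> K g) /\
    forall i, i \in r -> exists b, forall g (x : V) (t : R), K' g -> g (x + t *: delta_mx i 0) = g x + t *: b.
  elim=> [|i r [K' [bK' [K0' [sub hr]]]]]; first by exists K.
  have [b [g [Kg hg]]] := additive_along bK' K0' (nrm_delta i).
  exists (additive_along_dir (delta_mx i 0) b K'); split; first exact: blowup_class_additive.
  split; first by exists g.
  split; first by move=> h [/sub].
  move=> j; rewrite in_cons => /orP[/eqP ->|/hr [b' hb]]; first by exists b => h x t [].
  by exists b' => h x t [Kh _]; apply: hb.
move=> /(_ (index_enum 'I_n)) [K' [bK' [[g Kg] [sub hr]]]].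
have [b hb] := choice (fun i => hr i (mem_index_enum i)).
exists (\matrix_(i, j) b j i 0); suff <- : g = mulmx (\matrix_(i, j) b j i 0) by exact: sub.
apply/funext => x; rewrite {1}(vec_sum x).
have -> : (\matrix_(i, j) b j i 0) *m x = \sum_i x i 0 *: b i.
  by apply/matrixP => i j; rewrite ord1 mxE summxE; apply: eq_bigr => k _; rewrite !mxE mulrC.
elim/big_rec2: _ => [|i y1 y2 _ IH]; first exact: bc_at0 bK' _ Kg.
by rewrite addrC hb // IH addrC.
Qed.

(** On rays the potential is the quadratic [phi 0 + <B h, h> / 2], which only sees the symmetric
    part of [B]. The gradient inequality from [x] to [x + w] then bounds [<(B - B^T) x, w>] by a
    multiple of [|w|^2], which forces [B = B^T]. *)
Lemma linear_potential_sym (B : 'M[R]_n) : nonexpansive (mulmx B) -> has_potential (mulmx B) ->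
  B^T = B /\ forall v, 0 <= dotv v (B *m v).
Proof.
move=> nB [phi hphi].
have phiE h : phi h = phi 0 + dotv (B *m h) h / 2.
  set q := dotv (B *m h) h; pose p r := phi (r *: h) - r ^+ 2 * q / 2.
  have hp a b : p a - p b <= `|q| / 2 * (a - b) ^+ 2.
    have := hphi (a *: h) (b *: h); rewrite -scalerBl -scalemxAr dotvZl dotvZr -/q /p => h1.
    have : q * (a - b) ^+ 2 <= `|q| * (a - b) ^+ 2 by rewrite ler_wpM2r ?sqr_ge0 ?ler_norm.
    lra.
  have := @sq_lipschitz_const p (`|q| / 2) _ 1 0.
  rewrite /p scale0r scale1r => h1; suff : forall a b, `|p a - p b| <= `|q| / 2 * (a - b) ^+ 2.
    by move=> /h1; lra.
  move=> a b; rewrite ler_norml; have := hp a b; have := hp b a; lra.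
have pB v : 0 <= dotv v (B *m v).
  by have := hphi 0 v; rewrite (phiE v) mulmx0 dotv0l dotvC; lra.
split=> //; apply/matrixP => i j.
have symB x v : dotv (B *m x) v = dotv (B^T *m x) v.
  apply/eqP; rewrite -subr_eq0 -dotvBl; suff -> : B *m x - B^T *m x = 0 by rewrite dotv0l.
  apply: dotv_le0_eq0 => w; rewrite dotvBl (dotv_mulmx B^T) trmxK.
  have := hphi x (x + w); rewrite [x + w - x]addrAC subrr add0r (phiE x) (phiE (x + w)) mulmxDr !dotvE.
  have := nonexpansive_bound nB (mulmx0 _ B) w; have := cauchy_schwarz (B *m w) w.
  have : nrm (B *m w) * nrm w <= nrm w * nrm w -> nrm (B *m w) * nrm w <= dotv w w.
    by rewrite -expr2 nrm_sqr.
  move=> h1 h2 h3; have := h1 (ler_wpM2r (nrm_ge0 w) h3); rewrite (dotvC (B *m w) x); lra.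
by have := symB (delta_mx j 0) (delta_mx i 0); rewrite !dotv_delta -!colE !mxE.
Qed.
End Blowup.


(** * Convex functions and their proximal maps *)

Section Convex.
Context {R : realType} {n : nat}.
Local Notation V := 'cV[R]_n.
Variable q : V -> \bar R.
Hypotheses (qp : proper_fun q) (qc : convex_fun q) (ql : lsc_fun q).
Implicit Types x y u v w c : V.

Definition dom x : Prop := q x \is a fin_num.
Definition qr x : R := fine (q x).

Lemma qrE x : dom x -> q x = (qr x)%:E.
Proof. by move=> h; rewrite fineK. Qed.
Lemma dom_ltey x a : (q x <= a%:E)%E -> dom x.
Proof.
rewrite /dom; case: qp => /(_ x); rewrite fin_numE => -> _ /=.
by move=> h; apply/negP => /eqP e; move: h; rewrite e.
Qed.
Lemma ndom x : ~ dom x -> q x = +oo%E.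
Proof.
rewrite /dom fin_numE; case: qp => /(_ x) -> _ /=.
by move/negP; rewrite negbK => /eqP.
Qed.

Lemma qr_convex x y t : dom x -> dom y -> 0 < t < 1 ->
  dom (t *: x + (1 - t) *: y) /\ qr (t *: x + (1 - t) *: y) <= t * qr x + (1 - t) * qr y.
Proof.
move=> dx dy t01; have := qc x y t01; rewrite (qrE dx) (qrE dy) -!EFinM -EFinD => h.
have d := dom_ltey h; split=> //; by move: h; rewrite (qrE d) lee_fin.
Qed.

Lemma qr_ulsc (s : nat -> V) l (c : R) : (forall k, dom (s k)) -> ucvgV s l -> ucvg (qr \o s) c ->
  dom l /\ qr l <= c.
Proof.
move=> ds sl qs.
have h a : (a%:E < q l)%E -> a <= c.
  move=> /ql [d [d0 hd]]; apply: ucvg_le (ucvg_cst a) qs _.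
  apply: unear_mono (sl _ d0) => k /hd; rewrite (qrE (ds k)) lte_fin; exact: ltW.
have dl : dom l.
  have [//|/ndom e] := pselect (dom l).
  by have := h (c + 1); rewrite e ltry => /(_ isT); lra.
split=> //; rewrite leNgt; apply/negP => lt.
by have := h ((qr l + c) / 2); rewrite (qrE dl) lte_fin; lra.
Qed.

(** A downward cone is as good as an affine function for coercivity and avoids separation arguments.
    Lower semicontinuity bounds [qr] below on a ball around [x0]; a point [y] outside is pulled into
    the ball along the segment to [x0], and convexity turns the bound there into one at [y]. *)
Lemma affine_minorant : exists x0 C, 0 <= C /\
  dom x0 /\ forall y, dom y -> qr x0 - 1 - C * nrm (y - x0) <= qr y.
Proof.
have [x0 d0] := proj2 qp.
have [|d [dp hd]] := ql (x := x0) (a := qr x0 - 1); first by rewrite (qrE d0) lte_fin; lra.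
have C0 : 0 <= 2 / d by rewrite divr_ge0 // ltW.
exists x0, (2 / d); split=> //; split=> // y dy.
have [lt|ge] := ltP (nrm (y - x0)) d.
  have := hd _ lt; rewrite (qrE dy) lte_fin.
  have : 0 <= 2 / d * nrm (y - x0) by rewrite mulr_ge0 ?nrm_ge0.
  lra.
have np : 0 < nrm (y - x0) by apply: lt_le_trans ge.
(* This weight places the convex combination at distance [d / 2] from [x0]. *)
pose t := d / 2 / nrm (y - x0).
have t01 : 0 < t < 1.
  by rewrite /t divr_gt0 ?divr_gt0 //= ltr_pdivrMr // mul1r; apply: lt_le_trans ge; lra.
have := qr_convex dy d0 t01; set z := _ + _ => -[dz hz].
have : nrm (z - x0) < d.
  have -> : z - x0 = t *: (y - x0).
    by rewrite /z scalerBl scale1r scalerBr addrA addrAC addrK.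
  rewrite nrmZp; last by case/andP: t01 => /ltW.
  by rewrite /t divfK ?lt0r_neq0 //; lra.
move=> /hd; rewrite (qrE dz) lte_fin => h.
have : t * (qr x0 - qr y) < 1 by lra.
case/andP: t01 => t0 _; rewrite mulrC -ltr_pdivlMr // div1r.
have -> : t^-1 = 2 / d * nrm (y - x0) by rewrite /t !invf_div mulrC.
lra.
Qed.

Lemma subdiffE x v : subdiff q x v <->
  dom x /\ forall y, dom y -> qr x + dotv v (y - x) <= qr y.
Proof.
split=> -[dx h]; split=> // y.
  by move=> dy; have := h y; rewrite (qrE dx) (qrE dy) -EFinD lee_fin.
have [dy|/ndom ->] := pselect (dom y); last by rewrite leey.
by rewrite (qrE dx) (qrE dy) -EFinD lee_fin h.
Qed.

Lemma subdiff_mono x y v w : subdiff q x v -> subdiff q y w -> 0 <= dotv (v - w) (x - y).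
Proof.
move=> /subdiffE [dx hx] /subdiffE [dy hy]; have := hx _ dy; have := hy _ dx.
rewrite !dotvE; lra.
Qed.

(** The linear term is kept general to serve two purposes: [c = f x] gives the objective of
    [u_gamma], while [g = 1], [x = 0], [c = - w] gives the proximal problem at [w]. *)
Definition prox_obj (g : R) c x u := g / 2 * nrm u ^+ 2 + dotv c u + qr (x + u).
Definition prox_min (g : R) c x u :=
  dom (x + u) /\ forall w, dom (x + w) -> prox_obj g c x u <= prox_obj g c x w.

(** The quadratic term dominates both the linear term and the conical minorant of [qr], so the
    objective is bounded below with bounded sublevel sets and the direct method applies. *)
Lemma prox_min_ex g c x : 0 < g -> exists u, prox_min g c x u.
Proof.
move=> g0; have [x0 [C [C0 [d0 hq]]]] := affine_minorant.
pose K := nrm c + C; pose a1 := qr x0 - 1 - C * nrm (x - x0).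
have K0 : 0 <= K by rewrite addr_ge0 ?nrm_ge0.
have lb u : dom (x + u) -> g / 2 * nrm u ^+ 2 - K * nrm u + a1 <= prox_obj g c x u.
  move=> /hq h; have : C * nrm (x + u - x0) <= C * (nrm (x - x0) + nrm u).
    by rewrite ler_wpM2l // addrAC nrmD.
  have := cauchy_schwarzN c u; rewrite /prox_obj /K /a1; lra.
pose F0 := prox_obj g c x (x0 - x).
have [||||u [du hu]] := @attains_min _ _ (fun u => dom (x + u)) (prox_obj g c x) (x0 - x)
  (a1 - K ^+ 2 / (2 * g)) (1 + 2 * (K + `|F0 + 1 - a1|) / g) ; last by exists u.
- by rewrite addrC subrK.
- move=> u /lb; apply: le_trans.
  have : 0 <= g / 2 * (nrm u - K / g) ^+ 2 by rewrite mulr_ge0 ?sqr_ge0 ?divr_ge0 ?(ltW g0).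
  have -> : g / 2 * (nrm u - K / g) ^+ 2 = g / 2 * nrm u ^+ 2 - K * nrm u + K ^+ 2 / (2 * g).
    by field; rewrite lt0r_neq0.
  lra.
- move=> u /lb h1; rewrite -/F0 => h2.
  have h3 : nrm u * (g / 2 * nrm u - K) <= F0 + 1 - a1 by lra.
  rewrite leNgt; apply/negP => hn; set D := `|_| in hn.
  have D0 : F0 + 1 - a1 <= D by apply: ler_norm.
  have Dp : 0 <= D by apply: normr_ge0.
  have hn' : g + 2 * (K + D) < nrm u * g.
    by move: hn; rewrite -(ltr_pM2r g0) mulrDl mul1r divfK // lt0r_neq0.
  have n1 : 1 < nrm u.
    apply: le_lt_trans hn; rewrite lerDl divr_ge0 ?(ltW g0) // mulr_ge0 // addr_ge0 //.
  nra.
- move=> s l cc ds sl Fs.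
  have Q : ucvg (fun k => g / 2 * nrm (s k) ^+ 2 + dotv c (s k)) (g / 2 * nrm l ^+ 2 + dotv c l).
    apply: ucvgD; last exact: ucvg_dot (ucvgV_cst c) sl.
    have -> : (fun k => g / 2 * nrm (s k) ^+ 2) = (fun k => g / 2 * dotv (s k) (s k)).
      by apply/funext => k; rewrite nrm_sqr.
    by rewrite nrm_sqr; apply/ucvgZ/ucvg_dot.
  have Fs' : ucvg (qr \o (fun k => x + s k)) (cc - (g / 2 * nrm l ^+ 2 + dotv c l)).
    have := ucvgB Fs Q; congr ucvg; apply/funext => k; rewrite /= /prox_obj; ring.
  have [dl h] := qr_ulsc ds (ucvgVD (ucvgV_cst x) sl) Fs'.
  by split=> //; rewrite /prox_obj; lra.
Qed.

(** The optimality condition. Forwards, [u] is compared with [u + t d] for small [t], where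
    convexity handles [qr] and the quadratic error is of order [t^2]. Backwards, the term
    [g / 2 * |w - u|^2] is discarded. *)
Lemma prox_minP g c x u : 0 < g ->
  prox_min g c x u <-> subdiff q (x + u) (- (g *: u) - c).
Proof.
move=> g0; split.
  move=> [du hu]; apply/subdiffE; split=> // y dy.
  have [d dE] : exists d, d = y - (x + u) by eexists.
  rewrite -dE.
  have ht t : 0 < t < 1 -> qr (x + u) - qr y - g * dotv u d - dotv c d <= t * (g / 2 * dotv d d).
    move=> t01; have [] := qr_convex dy du t01.
    have -> : t *: y + (1 - t) *: (x + u) = x + (u + t *: d).
      by rewrite dE scalerBl scale1r scalerBr [RHS]addrA [RHS]addrCA.
    move=> dz hz; have := hu _ dz; rewrite /prox_obj !nrm_sqr !dotvE (dotvC d u) => h.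
    case/andP: t01 => t0 _; rewrite -(ler_pM2l t0); lra.
  rewrite !dotvE; rewrite -subr_ge0 leNgt; apply/negP => neg.
  set e := qr y - _ in neg.
  pose M := g / 2 * dotv d d.
  have M0 : 0 <= M by rewrite mulr_ge0 ?dotv_ge0 ?divr_ge0 ?(ltW g0).
  (* Chosen so that [t < 1] and [t * M < - e], which contradicts [ht]. *)
  pose t := (- e) / (2 * (M - e)).
  have Me : 0 < M - e by lra.
  have t0 : 0 < t by rewrite divr_gt0 ?mulr_gt0 //; lra.
  have tE : t * (2 * (M - e)) = - e by rewrite /t divfK // lt0r_neq0 // mulr_gt0.
  have t1 : t < 1 by rewrite ltr_pdivrMr ?mulr_gt0 // mul1r; lra.
  have := ht t; rewrite t0 t1 => /(_ isT); rewrite -/M.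
  have -> : qr (x + u) - qr y - g * dotv u d - dotv c d = - e by rewrite /e; ring.
  nra.
move=> /subdiffE [du hu]; split=> // w dw; have := hu _ dw.
have -> : x + w - (x + u) = w - u by rewrite opprD addrACA subrr add0r.
have := mulr_ge0 (ltW g0) (dotv_ge0 (w - u)).
rewrite /prox_obj !nrm_sqr !dotvE (dotvC w u); lra.
Qed.

Lemma is_u_gammaE g f x u : is_u_gamma g f q x u <-> prox_min g (f x) x u.
Proof.
have E v : dom (x + v) -> phi_obj g f q x v = (prox_obj g (f x) x v)%:E.
  move=> dv; rewrite /phi_obj (qrE dv) -EFinD /prox_obj; congr EFin.
  by rewrite mul1r [g / 2]mulrC.
split.
  move=> h; have [x0 d0] := proj2 qp.
  have d0' : dom (x + (x0 - x)) by rewrite addrC subrK.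
  have du : dom (x + u).
    have [//|/ndom e] := pselect (dom (x + u)).
    by have := h (x0 - x); rewrite (E _ d0') /phi_obj e addey.
  by split=> // w dw; have := h w; rewrite (E _ du) (E _ dw) lee_fin.
move=> [du h] w; have [dw|/ndom e] := pselect (dom (x + w)).
  by rewrite (E _ du) (E _ dw) lee_fin h.
by rewrite /phi_obj e addey // leey.
Qed.

Lemma is_u_gammaP g f x u : 0 < g ->
  is_u_gamma g f q x u <-> subdiff q (x + u) (- (g *: u) - f x).
Proof. by move=> g0; rewrite is_u_gammaE; apply: prox_minP. Qed.

Lemma is_u_gamma_ex g f x : 0 < g -> exists u, is_u_gamma g f q x u.
Proof. by move=> /(@prox_min_ex _ (f x) x) [u /is_u_gammaE]; exists u. Qed.

Lemma is_u_gamma_uniq g f x u u' : 0 < g ->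
  is_u_gamma g f q x u -> is_u_gamma g f q x u' -> u' = u.
Proof.
move=> g0 /(is_u_gammaP _ _ _ g0) h /(is_u_gammaP _ _ _ g0) h'.
have := subdiff_mono h' h.
have -> : x + u' - (x + u) = u' - u by rewrite opprD addrACA subrr add0r.
have -> : - (g *: u') - f x - (- (g *: u) - f x) = - (g *: (u' - u)).
  by rewrite opprB addrA addrNK scalerBr opprB addrC opprK.
rewrite dotvNl dotvZl oppr_ge0 pmulr_rle0 // => hle.
have /dotv_eq0/eqP : dotv (u' - u) (u' - u) = 0 by apply/eqP; rewrite eq_le hle dotv_ge0.
by rewrite subr_eq0 => /eqP.
Qed.

Lemma u_gammaP g f x : 0 < g -> subdiff q (x + u_gamma g f q x) (- (g *: u_gamma g f q x) - f x).
Proof.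
move=> g0; apply/is_u_gammaP => //; rewrite /u_gamma.
by have [u hu] := is_u_gamma_ex f x g0; case: xgetP => [y -> //|/(_ u)].
Qed.

Lemma u_gamma_eq g f x u : 0 < g -> subdiff q (x + u) (- (g *: u) - f x) -> u_gamma g f q x = u.
Proof.
move=> g0 /(is_u_gammaP _ _ _ g0) h; apply: is_u_gamma_uniq h _ => //.
exact/is_u_gammaP/u_gammaP.
Qed.

Lemma prox_ex : exists P : V -> V, (forall w, subdiff q (P w) (w - P w)) /\
  (forall p y, subdiff q p y -> P (p + y) = p).
Proof.
have h w : exists p, subdiff q p (w - p).
  have [u /(prox_minP _ _ _ ltr01)] := prox_min_ex (- w) 0 ltr01.
  by rewrite add0r scale1r opprK addrC; exists u.
have [P hP] := choice h; exists P; split=> // p y py.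
have := subdiff_mono (hP (p + y)) py.
have -> : p + y - P (p + y) - y = - (P (p + y) - p) by rewrite addrAC addrK opprB.
rewrite dotvNl oppr_ge0 => hle; apply/eqP; rewrite -subr_eq0; apply/eqP/dotv_eq0.
by apply/eqP; rewrite eq_le hle dotv_ge0.
Qed.

Lemma firmly_nonexpansive p y p' y' : subdiff q p y -> subdiff q p' y' ->
  dotv (p - p') (p - p') <= dotv (p - p') (p + y - (p' + y')).
Proof.
move=> h h'; have := subdiff_mono h h'.
have -> : p + y - (p' + y') = (p - p') + (y - y') by rewrite opprD addrACA.
by rewrite (dotvDr (p - p')) lerDl dotvC.
Qed.

Lemma prox_nonexpansive (P : V -> V) : (forall w, subdiff q (P w) (w - P w)) -> nonexpansive P.
Proof.
move=> hP x y; have h := firmly_nonexpansive (hP x) (hP y).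
rewrite [P x + (x - _)]addrC [P y + (y - _)]addrC !subrK in h.
 have h2 := cauchy_schwarz (P x - P y) (x - y).
have [->|ne] := pselect (P x - P y = 0); first by rewrite nrm0 nrm_ge0.
by rewrite -(ler_pM2l (nrm_gt0 ne)) -expr2 nrm_sqr; apply: le_trans h h2.
Qed.

(* The potential is the conjugate of [q + |.|^2 / 2]. *)
Lemma prox_potential (P : V -> V) : (forall w, subdiff q (P w) (w - P w)) -> has_potential P.
Proof.
move=> hP; exists (fun w => dotv w (P w) - dotv (P w) (P w) / 2 - qr (P w)) => x y.
have [dx _] := (subdiffE _ _).1 (hP x); have [dy hy] := (subdiffE _ _).1 (hP y).
have := hy _ dx; have := dotv_ge0 (P x - P y).
rewrite !dotvE (dotvC (P x) (P y)) (dotvC (P x) y) (dotvC (P x) x); lra.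
Qed.
End Convex.


(** * Blow-ups of a nonexpansive gradient map *)

Section Pairs.
Context {R : realType} {n : nat}.
Local Notation V := 'cV[R]_n.
Implicit Types a b : V * V.

Lemma dotp_ge0 a : 0 <= dotp a a.
Proof. by rewrite addr_ge0 ?dotv_ge0. Qed.
Lemma nrmp_ge0 a : 0 <= nrmp a. Proof. exact: sqrtr_ge0. Qed.
Lemma nrmp_sqr a : nrmp a ^+ 2 = nrm a.1 ^+ 2 + nrm a.2 ^+ 2.
Proof. by rewrite sqr_sqrtr ?dotp_ge0 // !nrm_sqr. Qed.
Lemma nrmp_le_sum a : nrmp a <= nrm a.1 + nrm a.2.
Proof.
rewrite -(ler_pXn2r (_ : 0 < 2)%N) ?nnegrE ?nrmp_ge0 ?addr_ge0 ?nrm_ge0 // nrmp_sqr.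
have := mulr_ge0 (nrm_ge0 a.1) (nrm_ge0 a.2); nra.
Qed.
Lemma nrm1_le_nrmp a : nrm a.1 <= nrmp a.
Proof.
rewrite -(ler_pXn2r (_ : 0 < 2)%N) ?nnegrE ?nrmp_ge0 ?nrm_ge0 // nrmp_sqr.
by rewrite lerDl sqr_ge0.
Qed.
Lemma nrm2_le_nrmp a : nrm a.2 <= nrmp a.
Proof.
rewrite -(ler_pXn2r (_ : 0 < 2)%N) ?nnegrE ?nrmp_ge0 ?nrm_ge0 // nrmp_sqr.
by rewrite lerDr sqr_ge0.
Qed.

Lemma cvgP_bound (s : nat -> V * V) l (C : R) :
  (forall k, nrmp (psub (s k) l) <= C * k.+1%:R^-1) -> Defs.cvgP s l.
Proof.
move=> h e e0; have [K hK] := ex_nat_gt (C / e).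
exists K => k Kk; apply: le_lt_trans (h k) _.
rewrite ltr_pdivrMr ?ltr0Sn // mulrC -ltr_pdivrMr //; apply: lt_trans hK _.
by rewrite ltr_nat ltnS.
Qed.
End Pairs.

(** * The class of blow-up limits at a point *)

Section TangentBlowup.
Context {R : realType} {n : nat}.
Local Notation V := 'cV[R]_n.
Implicit Types (g P : V -> V).

Lemma nonexpansive_ulim (gk : nat -> V -> V) : (forall k, nonexpansive (gk k)) ->
  (forall k, gk k 0 = 0) -> exists g, forall x, ucvgV (gk^~ x) (g x).
Proof.
move=> nk k0; have h x : exists l, ucvgV (gk^~ x) l.
  by apply: (@ucvgV_bounded _ _ _ (nrm x)) => k; apply: nonexpansive_bound.
by have [g hg] := choice h; exists g.
Qed.

Lemma nonexpansive_lim (gk : nat -> V -> V) g : (forall k, nonexpansive (gk k)) ->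
  (forall x, ucvgV (gk^~ x) (g x)) -> nonexpansive g.
Proof.
move=> nk hg x y.
apply: ucvg_le (ucvg_nrm (ucvgVB (hg x) (hg y))) (ucvg_cst (nrm (x - y))) _.
by apply: (@unear_eventually _ 0) => k _; apply: nk.
Qed.

(** Potentials are determined up to constants only; normalised to vanish at [0] they are bounded by
    [|x|^2], so they have pointwise limits, which serve as a potential of [g]. *)
Lemma has_potential_lim (gk : nat -> V -> V) g : (forall k, nonexpansive (gk k)) ->
  (forall k, gk k 0 = 0) -> (forall k, has_potential (gk k)) ->
  (forall x, ucvgV (gk^~ x) (g x)) -> has_potential g.
Proof.
move=> nk k0 pk hg; have [phi hphi] := choice pk.
have bd x k : `|phi k x - phi k 0| <= dotv x x.
  have := hphi k x 0; have := hphi k 0 x.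
  rewrite k0 dotv0l addr0 sub0r dotvNr ler_norml => h1 h2.
  have h3 : dotv (gk k x) x <= dotv x x.
    apply: le_trans (cauchy_schwarz _ _) _; rewrite -nrm_sqr expr2 ler_wpM2r ?nrm_ge0 //.
    exact: nonexpansive_bound.
  have := dotv_ge0 x; lra.
have [psi hpsi] := choice (fun x => ucvg_bounded (bd x)).
exists psi => x y.
apply: ucvg_le (ucvgD (hpsi x) (ucvg_dot (hg x) (ucvgV_cst (y - x)))) (hpsi y) _.
apply: (@unear_eventually _ 0) => k _; have := hphi k x y; lra.
Qed.

Lemma rescale0 g x0 (eps : R) : rescale g x0 eps 0 = 0.
Proof. by rewrite /rescale scaler0 addr0 subrr scaler0. Qed.

Lemma rescale_nonexpansive g x0 (eps : R) : 0 < eps -> nonexpansive g ->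
  nonexpansive (rescale g x0 eps).
Proof.
move=> e0 ng x y; rewrite /rescale -scalerBr opprB addrA subrK.
rewrite nrmZp ?invr_ge0 ?(ltW e0) // ler_pdivrMl //.
by apply: le_trans (ng _ _) _; rewrite opprD addrACA subrr add0r -scalerBr nrmZp // ltW.
Qed.

Lemma rescale_potential g x0 (eps : R) : 0 < eps -> has_potential g ->
  has_potential (rescale g x0 eps).
Proof.
move=> e0 [phi hphi].
exists (fun h => eps^-1 ^+ 2 * phi (x0 + eps *: h) - eps^-1 * dotv (g x0) h) => x y.
have := hphi (x0 + eps *: x) (x0 + eps *: y).
rewrite opprD addrACA subrr add0r -scalerBr => h.
rewrite /rescale dotvZl dotvBl (dotvBr _ _ (g x0)).
have : eps^-1 ^+ 2 * (phi (x0 + eps *: x) + dotv (g (x0 + eps *: x)) (eps *: (y - x)))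
   <= eps^-1 ^+ 2 * phi (x0 + eps *: y) by rewrite ler_wpM2l ?sqr_ge0.
rewrite dotvZr mulrDr; set d := dotv (g _) (y - x).
have -> : eps^-1 ^+ 2 * (eps * d) = eps^-1 * d by field; rewrite lt0r_neq0.
lra.
Qed.

Lemma rescale_rescale g x0 x1 (eps eps1 : R) : 0 < eps -> 0 < eps1 -> forall h,
  rescale (rescale g x0 eps) x1 eps1 h = rescale g (x0 + eps *: x1) (eps * eps1) h.
Proof.
move=> e0 e1 h; rewrite /rescale -scalerBr opprB addrA subrK scalerA -invfM mulrC.
by rewrite [eps *: (x1 + _)]scalerDr scalerA [x0 + (_ + _)]addrA.
Qed.

(** An equi-Lipschitz family that converges pointwise converges uniformly on bounded sets: offending
    points accumulate at some [l], and convergence at [l] is contradicted. *)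
Lemma uniform_on_balls (gk : nat -> V -> V) g (M eta : R) : (forall k, nonexpansive (gk k)) ->
  (forall x, ucvgV (gk^~ x) (g x)) -> 0 < eta ->
  unear (fun k => forall h, nrm h <= M -> nrm (gk k h - g h) <= eta).
Proof.
move=> nk hg eta0.
have [//|bad] := unear_em (fun k => forall h, nrm h <= M -> nrm (gk k h - g h) <= eta).
(* A point is needed for every index in order to pass to a limit, so [0] is taken when there is no
   offending one; the bound uses the absolute value of [M] to cover that default. *)
have hk k : exists h, nrm h <= `|M| /\
    ((exists h, nrm h <= M /\ eta < nrm (gk k h - g h)) -> eta < nrm (gk k h - g h)).
  have [[h [hM hh]]|no] := pselect (exists h, nrm h <= M /\ eta < nrm (gk k h - g h)).
    by exists h; split=> //; apply: le_trans hM (ler_norm _).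
  by exists 0; rewrite nrm0 normr_ge0; split=> // /no.
have [h hh] := choice hk.
have [l hl] := ucvgV_bounded (fun k => proj1 (hh k)).
have ng := nonexpansive_lim nk hg.
have e3 : 0 < eta / 3 by lra.
have [k [bk [h1 h2]]] := unear_ex (unear_and bad (unear_and (hl _ e3) (hg l _ e3))).
have /(proj2 (hh k)) : exists h, nrm h <= M /\ eta < nrm (gk k h - g h).
  apply: contrapT => no; apply: bk => z zM; rewrite leNgt; apply/negP => lt.
  by apply: no; exists z.
have := nrm_tri (gk k (h k)) (gk k l) (g (h k)); have := nrm_tri (gk k l) (g l) (g (h k)).
have := nk k (h k) l; have := ng l (h k); rewrite [nrm (l - _)]nrmBC; lra.
Qed.

(** The base point [w'] may differ from [w]; without this freedom the class would not be closed
    under recentring. A single [eta] controls the scale, the displacement of the base point, the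
    radius [1 / eta] and the error. *)
Definition tangent_class P w g : Prop :=
  [/\ nonexpansive g, has_potential g, g 0 = 0 &
   forall eta : R, 0 < eta -> exists w' eps, [/\ 0 < eps < eta, nrm (w' - w) < eta &
     forall h, nrm h <= eta^-1 -> nrm (rescale P w' eps h - g h) <= eta]].

Lemma tangent_class_blowup P w : nonexpansive P -> blowup_class (tangent_class P w).
Proof.
move=> nP; split; [by move=> g []|by move=> g []|by move=> g []| |].
- move=> g x0 e e0 [ng pg g0 hg]; split.
  + exact: rescale_nonexpansive.
  + exact: rescale_potential.
  + exact: rescale0.
  + move=> eta eta0.
    (* Each summand pays for one requirement at the new scale: the error doubled and divided by [e],
       the scale [eps * e], the displacement of the base point, and, through [e / eta + |x0|], the
       radius. *)
    pose d := 1 + 2 / (e * eta) + e / eta + (1 + nrm x0) / eta + nrm x0.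
    have p1 : 0 < 2 / (e * eta) by rewrite divr_gt0 ?mulr_gt0.
    have p2 : 0 < e / eta by rewrite divr_gt0.
    have p3 : 0 < (1 + nrm x0) / eta.
      by rewrite divr_gt0 //; have := nrm_ge0 x0; lra.
    have p4 := nrm_ge0 x0.
    have d0 : 0 < d by rewrite /d; lra.
    have [|w' [eps [/andP[eps0 epsd] hw happ]]] := hg d^-1; first by rewrite invr_gt0.
    have epsd1 : eps * d < 1 by rewrite -ltr_pdivlMr // div1r.
    exists (w' + eps *: x0), (eps * e); split.
    * rewrite mulr_gt0 //=; rewrite -ltr_pdivlMr // -[eta / e]invrK.
      apply: lt_le_trans epsd _; rewrite lef_pV2 ?posrE ?invr_gt0 ?divr_gt0 //.
      by rewrite invf_div /d; lra.
    * rewrite addrAC; apply: le_lt_trans (nrmD _ _) _; rewrite nrmZp ?(ltW eps0) //.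
      have : nrm (w' - w) + eps * nrm x0 < d^-1 * (1 + nrm x0).
        rewrite mulrDr mulr1; apply: ltr_leD => //; rewrite ler_wpM2r //; exact: ltW.
      move=> h; apply: lt_le_trans h _; rewrite mulrC ler_pdivrMr // -ler_pdivrMl // mulrC.
      by rewrite /d; lra.
    * move=> h hh; rewrite -rescale_rescale // /rescale -/(rescale P w' eps).
      rewrite -/(rescale P w' eps (x0 + e *: h)) -/(rescale P w' eps x0).
      rewrite -scalerBr nrmZp ?invr_ge0 ?(ltW e0) // ler_pdivrMl //.
      have hxd : nrm (x0 + e *: h) <= d^-1^-1.
        rewrite invrK; apply: le_trans (nrmD _ _) _; rewrite nrmZp ?(ltW e0) //.
        have : e * nrm h <= e / eta by rewrite ler_pM2l.
        by rewrite /d; lra.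
      have hx0 : nrm x0 <= d^-1^-1 by rewrite invrK /d; lra.
      have -> : forall a b c c' : V, a - b - (c - c') = (a - c) - (b - c').
        by move=> a b c c'; rewrite !opprD !opprK addrACA.
      apply: le_trans (nrmB _ _) _.
      have := happ _ hxd; have := happ _ hx0.
      have : 2 * d^-1 <= e * eta.
        rewrite ler_pdivrMr // mulrC -ler_pdivrMr ?mulr_gt0 // /d; lra.
      rewrite /rescale; lra.
- move=> gk g hk hg.
  have nk k : nonexpansive (gk k) by case: (hk k).
  have k0 k : gk k 0 = 0 by case: (hk k).
  split.
  + exact: nonexpansive_lim nk hg.
  + by apply: has_potential_lim hg => // k; case: (hk k).
  + by apply: ucvgV_uniq (hg 0) _ => e e0; apply: (@unear_eventually _ 0) => k _; rewrite k0 subr0 nrm0.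
  + move=> eta eta0; have e2 : 0 < eta / 2 by lra.
    have [k hu] := unear_ex (uniform_on_balls eta^-1 nk hg e2).
    have [_ _ _ happ] := hk k; have [w' [eps [/andP[eps0 epsd] hw hr]]] := happ _ e2.
    exists w', eps; split; [by rewrite eps0 /=; lra|lra|move=> h hh].
    have hh2 : nrm h <= (eta / 2)^-1.
      by apply: le_trans hh _; rewrite lef_pV2 ?posrE //; lra.
    have := hu h hh; have := hr h hh2.
    have := nrm_tri (rescale P w' eps h) (gk k h) (g h); lra.
Qed.

Lemma tangent_class_nonempty P w : nonexpansive P -> has_potential P ->
  exists g, tangent_class P w g.
Proof.
move=> nP pP; pose gk k := rescale P w k.+1%:R^-1.
have i0 k : 0 < k.+1%:R^-1 :> R by rewrite invr_gt0 ltr0Sn.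
have nk k : nonexpansive (gk k) by apply: rescale_nonexpansive.
have k0 k : gk k 0 = 0 by apply: rescale0.
have [g hg] := nonexpansive_ulim nk k0.
exists g; split.
- exact: nonexpansive_lim nk hg.
- by apply: has_potential_lim hg => // k; apply: rescale_potential.
- by apply: ucvgV_uniq (hg 0) _ => e e0; apply: (@unear_eventually _ 0) => k _; rewrite k0 subr0 nrm0.
- move=> eta eta0.
  have [k [hk1 hk2]] := unear_ex (unear_and (@ucvg_inv R _ eta0) (uniform_on_balls eta^-1 nk hg eta0)).
  exists w, k.+1%:R^-1; split=> //; last by rewrite subrr nrm0.
  by rewrite i0 /=; move: hk1; rewrite subr0 ger0_norm // ltW.
Qed.

Lemma tangent_linear P w : nonexpansive P -> has_potential P ->
  exists B : 'M[R]_n, [/\ B^T = B, (forall v, 0 <= dotv v (B *m v)),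
    (forall v, nrm (B *m v) <= nrm v) & tangent_class P w (mulmx B)].
Proof.
move=> nP pP.
have [B KB] := blowup_class_linear (tangent_class_blowup w nP) (tangent_class_nonempty w nP pP).
have [nB pB _ _] := KB; have [sB psB] := linear_potential_sym nB pB.
exists B; split=> // v; exact: nonexpansive_bound nB (mulmx0 _ B) v.
Qed.
End TangentBlowup.


(** * Existence of the Newton matrix *)

Section NewtonMatrix.
Context {R : realType} {n : nat}.
Local Notation V := 'cV[R]_n.
Variables (T : V -> V -> Prop) (P : V -> V).
Hypotheses (TP : forall w, T (P w) (w - P w)) (PT : forall p y, T p y -> P (p + y) = p).
Hypothesis nP : nonexpansive P.

(** The graph of [T] is parametrised by [W = p + y] through [P]. Since [h0] is interior, minimality
    can be tested at every graph point near the base point, and it reads [<v, p' - P w> <= <b + 2 C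
    h0, W - w> + C / eps * |W - w|^2]. The quadratic remainder is negligible in the definition of a
    regular normal. *)
Lemma resolvent_reg_normal (w w' h0 b v : V) (C eps : R) : 0 < eps -> 0 <= C ->
  nrm h0 < 1 -> w = w' + eps *: h0 ->
  (forall h, nrm h <= 1 ->
     C * dotv h0 h0 + dotv b h0 - dotv v (rescale P w' eps h0)
     <= C * dotv h h + dotv b h - dotv v (rescale P w' eps h)) ->
  reg_normal (gph T) (P w, w - P w) (v - (b + (2 * C) *: h0), - (b + (2 * C) *: h0)).
Proof.
move=> eps0 C0 hh0 wE hmin; split; first exact: TP.
move=> e e0; pose K := 4 * C / eps.
have K0 : 0 <= K by rewrite divr_ge0 ?mulr_ge0 // ltW.
have e1 := lt0r_neq0 eps0.
pose d := Num.min (eps * (1 - nrm h0) / 2) (e / (K + 1)).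
have d0 : 0 < d by rewrite lt_min !divr_gt0 ?mulr_gt0 //; lra.
exists d; split=> // -[p' y'] /= hT.
set nz := nrmp _; rewrite lt_min => /andP[hd1 hd2].
have n0 : 0 <= nz by apply: nrmp_ge0.
have [W WE] : exists W, W = p' + y' by eexists.
have Pp : P W = p' by rewrite WE; apply: PT hT.
have hW : nrm (W - w) <= 2 * nz.
  have -> : W - w = (p' - P w) + (y' - (w - P w)) by rewrite WE; vring.
  apply: le_trans (nrmD _ _) _.
  have := nrm1_le_nrmp (psub (p', y') (P w, w - P w)).
  have := nrm2_le_nrmp (psub (p', y') (P w, w - P w)); rewrite /= -/nz; lra.
have [D DE] : exists D, D = eps^-1 *: (W - w) by eexists.
have WD : W - w = eps *: D by rewrite DE scalerA divff // scale1r.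
have hh : nrm (h0 + D) <= 1.
  apply: le_trans (nrmD _ _) _.
  rewrite DE nrmZp ?invr_ge0 ?(ltW eps0) // -lerBrDl ler_pdivrMl //; lra.
have R1 : rescale P w' eps h0 = eps^-1 *: (P w - P w') by rewrite /rescale -wE.
have R2 : rescale P w' eps (h0 + D) = eps^-1 *: (p' - P w').
  rewrite /rescale -Pp; congr (_ *: (P _ - _)).
  by rewrite scalerDr addrA -wE -WD addrC subrK.
have h2 : eps * dotv v (p' - P w) <= eps * (dotv (b + (2 * C) *: h0) (W - w)) + C * dotv (W - w) (W - w).
  have h3 : 0 <= eps * (2 * C * dotv h0 D + C * dotv D D + dotv b D) - dotv v (p' - P w).
    have := hmin _ hh; rewrite R1 R2 -[in X in X -> _](ler_pM2l eps0).
    rewrite !dotvE (dotvC D h0) => h; move: h; rewrite !mulrBr ![eps * (eps^-1 * _)]mulVKf // !mulrDr; lra.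
  rewrite WD !dotvE; have := mulr_ge0 (ltW eps0) h3; rewrite !dotvE; lra.
rewrite /dotp /= (dotvBl v).
have -> : dotv (- (b + (2 * C) *: h0)) (y' - (w - P w)) =
    - dotv (b + (2 * C) *: h0) (W - w) + dotv (b + (2 * C) *: h0) (p' - P w).
  by rewrite dotvNl -!dotvNr -dotvDr; congr dotv; rewrite WE; vring.
have h4 : C * dotv (W - w) (W - w) <= C * (4 * nz ^+ 2).
  by rewrite ler_wpM2l // -nrm_sqr; have := nrm_ge0 (W - w); nra.
have h5 : C * (4 * nz ^+ 2) = eps * (K * nz ^+ 2) by rewrite /K; field.
have h6 : K * nz ^+ 2 <= e * nz.
  rewrite expr2 mulrA ler_wpM2r //; move: hd2; rewrite ltr_pdivlMr; [nra|lra].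
rewrite -(ler_pM2l eps0).
have : eps * (K * nz ^+ 2) <= eps * (e * nz) by rewrite ler_pM2l.
lra.
Qed.

Lemma newton_matrix_ex (w : V) : has_potential P ->
  exists G : 'M[R]_n, [/\ G^T = G, (forall v, 0 <= dotv v (G *m v)),
    (forall v, nrm (G *m v) <= nrm v) &
    forall v, coderiv T (P w) (w - P w) ((1%:M - G) *m v) (G *m v)].
Proof.
move=> pP; have [B [sB pB cB KB]] := tangent_linear w nP pP.
have GE v : (1%:M - B) *m v = v - B *m v by rewrite mulmxBl mul1mx.
exists (1%:M - B); split.
- by rewrite linearB /= trmx1 sB.
- move=> v; rewrite GE dotvBr subr_ge0 -nrm_sqr.
  by apply: le_trans (cauchy_schwarz _ _) _; rewrite expr2 ler_wpM2l ?nrm_ge0.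
- by move=> v; apply: psd_compl_contraction.
move=> v; have -> : (1%:M - (1%:M - B)) *m v = B *m v by rewrite opprB addrC subrK.
rewrite GE.
have nv := nrm_ge0 v.
have key k : exists z b, [/\ reg_normal (gph T) z (v - b, - b),
    nrmp (psub z (P w, w - P w)) <= 6 * k.+1%:R^-1 & 
    nrm (b - B *m v) <= 2 * (nrm v + 1) * k.+1%:R^-1].
  set eta : R := k.+1%:R^-1.
  have eta0 : 0 < eta by rewrite invr_gt0 ltr0Sn.
  have eta1 : eta <= 1 by rewrite invf_le1 ?ltr0Sn // ler1n.
  have [_ _ _ happ] := KB.
  have [w' [eps [/andP[eps0 epse] hw hr]]] := happ _ eta0.
  (* [F] differs from [C |h|^2] by at most [eta * |v|] on the unit ball. This [C] just exceeds that
     error, which keeps the minimiser in the interior, and still tends to [0] with [eta], so that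
     the slope [B v + 2 C h0] tends to [B v]. *)
  pose C := eta * (nrm v + 1).
  have C0 : 0 < C by rewrite mulr_gt0 //; lra.
  pose F h := C * dotv h h + dotv (B *m v) h - dotv v (rescale P w' eps h).
  have nR := rescale_nonexpansive w' eps0 nP.
  have lb h : nrm h <= 1 -> C * dotv h h - eta * nrm v <= F h.
    move=> h1; rewrite /F dotv_mulmx sB.
    have : nrm (rescale P w' eps h - B *m h) <= eta.
      by apply: hr; apply: le_trans h1 _; rewrite invr_ge1 ?unitfE ?lt0r_neq0.
    have := cauchy_schwarz v (rescale P w' eps h - B *m h); rewrite dotvBr => h2 h3.
    have : nrm v * nrm (rescale P w' eps h - B *m h) <= nrm v * eta by rewrite ler_wpM2l.
    lra.
  have [||||h0 [h01 hmin]] := @attains_min _ _ (fun h => nrm h <= 1) F 0 (- (eta * nrm v)) 1.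
  - by rewrite nrm0.
  - move=> h h1; have := lb h h1; have := mulr_ge0 (ltW C0) (dotv_ge0 h); lra.
  - by [].
  - move=> s l c hs sl Fs; split.
      by apply: ucvg_le (ucvg_nrm sl) (ucvg_cst 1) _; apply: (@unear_eventually _ 0) => j _; apply: hs.
    have Rl : ucvgV (fun j => rescale P w' eps (s j)) (rescale P w' eps l).
      by apply: (ucvgV_bound ((ucvgV_nrm _ _).1 sl)); apply: (@unear_eventually _ 0) => j _; apply: nR.
    have := ucvgB (ucvgD (ucvgZ C (ucvg_dot sl sl)) (ucvg_dot (ucvgV_cst (B *m v)) sl))
      (ucvg_dot (ucvgV_cst v) Rl).
    by move=> /(ucvg_uniq Fs) ->.
  have F0 : F 0 = 0 by rewrite /F rescale0 !dotv0r; ring.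
  have h0lt : nrm h0 < 1.
    have := lb _ h01; have := hmin 0; rewrite nrm0 F0 ler01 => /(_ isT) f1 f2.
    have : C * nrm h0 ^+ 2 < C * 1.
      rewrite nrm_sqr; have : C = eta * nrm v + eta by rewrite /C; ring.
      lra.
    by rewrite ltr_pM2l // expr_lt1 // nrm_ge0.
  pose ws := w' + eps *: h0.
  have wsd : nrm (ws - w') < eps.
    by rewrite /ws addrC addKr nrmZp ?(ltW eps0) // gtr_pMr.
  exists (P ws, ws - P ws), (B *m v + (2 * C) *: h0); split.
  - by apply: resolvent_reg_normal h0lt _ hmin => //; apply: ltW.
  - apply: le_trans (nrmp_le_sum _) _; rewrite /=.
    have hws : nrm (ws - w) < 2 * eta by have := nrm_tri ws w' w; lra.
    have := nP ws w; have := nrmB (ws - w) (P ws - P w).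
    have -> : ws - w - (P ws - P w) = ws - P ws - (w - P w) by vring.
    lra.
  - rewrite addrC addKr nrmZp; last by rewrite mulr_ge0 // ltW.
    have : C * nrm h0 <= C * 1 by rewrite ler_pM2l.
    rewrite /C; lra.
have [z hz] := choice key; have [b hb] := choice hz.
split; first exact: TP.
exists z, (fun k => (v - b k, - b k)); split; first by move=> k; case: (hb k).
split; first by apply: (cvgP_bound (C := 6)) => k; case: (hb k).
apply: (cvgP_bound (C := 4 * (nrm v + 1))) => k; case: (hb k) => _ _ h.
apply: le_trans (nrmp_le_sum _) _; rewrite /=.
have -> : v - b k - (v - B *m v) = - (b k - B *m v) by rewrite !opprB addrC subrKA.
have -> : - b k - - (B *m v) = - (b k - B *m v) by rewrite opprB opprK addrC.
rewrite nrmN; move: h; move: (nrm (b k - _)) (_^-1) => r a; lra.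
Qed.
End NewtonMatrix.


(** * Smooth strongly monotone maps *)

Section Smooth.
Context {R : realType} {n : nat}.
Local Notation V := 'cV[R]_n.
Variables (f : V -> V) (J : V -> 'M[R]_n).
Hypothesis fC1 : C1_with_jacobian f J.
Implicit Types (x y z h : V).

Lemma near_all (I : finType) (x : V) (Q : I -> V -> Prop) :
  (forall i, exists d : R, 0 < d /\ forall y, nrm (y - x) < d -> Q i y) ->
  exists d : R, 0 < d /\ forall y, nrm (y - x) < d -> forall i, Q i y.
Proof.
move=> hQ; have : forall r : seq I, exists d : R, 0 < d /\
    forall y, nrm (y - x) < d -> forall i, i \in r -> Q i y.
  elim=> [|i r [d [d0 hd]]]; first by exists 1.
  have [d' [d0' hd']] := hQ i; exists (Num.min d d'); split; first by rewrite lt_min d0.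
  move=> y; rewrite lt_min => /andP[h1 h2] j; rewrite in_cons => /orP[/eqP ->|].
    exact: hd'.
  exact: hd.
move=> /(_ (index_enum I)) [d [d0 hd]]; exists d; split=> // y hy i.
by apply: hd hy _ _; rewrite mem_index_enum.
Qed.

Lemma jacobian_cont x e : 0 < e -> exists d : R, 0 < d /\
  forall y, nrm (y - x) < d -> forall h, nrm ((J y - J x) *m h) <= e * nrm h.
Proof.
move=> e0; pose e' := e / (n%:R * n%:R + 1).
have N0 : 0 <= n%:R * n%:R :> R by rewrite mulr_ge0.
have e'0 : 0 < e' by rewrite divr_gt0 //; lra.
have [d [d0 hd]] := near_all (Q := fun i y => forall j, `|J y i j - J x i j| < e')
  (fun i => near_all (fun j => fC1.2 x i j e' e'0)).
exists d; split=> // y hy h; apply: le_trans (nrm_mulmx _ _) _.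
rewrite ler_wpM2r ?nrm_ge0 //.
have : mxnorm1 (J y - J x) <= n%:R * n%:R * e'.
  by apply: mxnorm1_le => i j; rewrite !mxE; apply/ltW/hd.
move=> h1; apply: le_trans h1 _.
rewrite /e' mulrC -mulrA ger_pMr // mulrC ler_pdivrMr ?mul1r; lra.
Qed.

Lemma loc_lipschitz x : exists d K : R, [/\ 0 < d, 0 <= K &
  forall y, nrm (y - x) < d -> nrm (f y - f x) <= K * nrm (y - x)].
Proof.
have [d [d0 hd]] := fC1.1 x 1 ltr01.
exists d, (mxnorm1 (J x) + 1); split=> //; first by rewrite addr_ge0 ?mxnorm1_ge0.
move=> y /hd h; have := nrm_mulmx (J x) (y - x).
have := nrmD (f y - f x - J x *m (y - x)) (J x *m (y - x)); rewrite subrK; lra.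
Qed.

Lemma f_ucvg s l : ucvgV s l -> ucvgV (fun k => f (s k)) (f l).
Proof.
move=> sl; have [d [K [d0 K0 h]]] := loc_lipschitz l.
have /(ucvgZ K) := (ucvgV_nrm _ _).1 sl; rewrite mulr0 => hK.
apply: (ucvgV_bound hK); apply: unear_mono (sl _ d0) => k; exact: h.
Qed.

(** Strong monotonicity is applied to [x + t h] and [x] with small [t] and divided by [t^2];
    differentiability at [x] costs an arbitrarily small multiple of [|h|^2]. *)
Lemma jacobian_mono (mu : R) : 
  (forall x1 x2, dotv (f x1 - f x2) (x1 - x2) >= mu * nrm (x1 - x2) ^+ 2) ->
  forall x h, mu * dotv h h <= dotv (J x *m h) h.
Proof.
move=> hmu x h.
suff key e : 0 < e -> mu * dotv h h <= dotv (J x *m h) h + e * dotv h h.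
  rewrite leNgt; apply/negP => lt; have h0 := dotv_ge0 h.
  have := key ((mu * dotv h h - dotv (J x *m h) h) / (2 * (dotv h h + 1))).
  set e := _ / _ => /(_ _) k; have e0 : 0 < e by rewrite divr_gt0; lra.
  have : e * (2 * (dotv h h + 1)) = mu * dotv h h - dotv (J x *m h) h.
    by rewrite /e divfK // lt0r_neq0 //; lra.
  have := k e0; nra.
move=> e0; have [d [d0 hd]] := fC1.1 x e e0.
have h0 := nrm_ge0 h.
pose t := d / (nrm h + 1) / 2.
have t0 : 0 < t by rewrite !divr_gt0 //; lra.
have xh : x + t *: h - x = t *: h by rewrite addrAC subrr add0r.
have th : nrm (x + t *: h - x) < d.
  rewrite xh nrmZp ?(ltW t0) //.
  have : t * 2 * (nrm h + 1) = d by rewrite /t !divfK ?lt0r_neq0 //; lra.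
  nra.
have := hmu (x + t *: h) x; have := hd _ th.
rewrite xh => h1.
have := cauchy_schwarz (f (x + t *: h) - f x - J x *m (t *: h)) (t *: h).
move: h1; rewrite nrmZp ?(ltW t0) //.
set r := f _ - f x; set N := nrm (r - _) => h1.
rewrite -scalemxAr dotvBl !dotvZr dotvZl exprMn nrm_sqr => h2 h3.
have h4 : N * (t * nrm h) <= e * (t * nrm h) * (t * nrm h) by rewrite ler_wpM2r // mulr_ge0 // ltW.
have h5 : t ^+ 2 * (mu * dotv h h) <= t ^+ 2 * (dotv (J x *m h) h + e * dotv h h).
  have e4 : e * (t * nrm h) * (t * nrm h) = e * (t ^+ 2 * dotv h h) by rewrite -nrm_sqr; ring.
  rewrite e4 in h4; lra.
by move: h5; rewrite ler_pM2l // exprn_gt0.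
Qed.

(** Continuous induction on the unit interval, used in place of a mean value inequality: the
    supremum of the [t] up to which the bound holds belongs to the set and can be exceeded unless it
    is [1]. *)
Lemma local_to_global_lipschitz (p : R -> V) (L : R) : 0 <= L ->
  (forall t, 0 <= t <= 1 -> exists d : R, 0 < d /\
     forall s, 0 <= s <= 1 -> `|s - t| < d -> nrm (p s - p t) <= L * `|s - t|) ->
  nrm (p 1 - p 0) <= L.
Proof.
move=> L0 hp; pose E := [set t | 0 <= t <= 1 /\ nrm (p t - p 0) <= L * t]%classic.
have E0 : E 0 by rewrite /E /= lexx ler01 subrr nrm0 mulr0.
have supE : has_sup E by split; [exists 0|exists 1 => t [/andP[]]].
have c0 : 0 <= sup E by apply: ub_le_sup => //; case: supE.
have c1 : sup E <= 1 by apply: ge_sup => [|t [/andP[]]]; first by exists 0.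
have [|d [d0 hd]] := hp (sup E); first by rewrite c0.
have Ec : nrm (p (sup E) - p 0) <= L * sup E.
  have [t Et lt] := sup_adherent d0 supE; have [/andP[t0 t1] ht] := Et.
  have tle : t <= sup E by apply: ub_le_sup => //; case: supE.
  have := hd t; rewrite t0 t1 distrC ger0_norm ?subr_ge0 // => /(_ isT) h.
  have lt' : sup E - t < d by lra.
  have := h lt'; rewrite nrmBC => h'.
  have := nrm_tri (p (sup E)) (p t) (p 0); lra.
have [lt1|ge1] := ltP (sup E) 1; last first.
  by have e1 : sup E = 1 by [apply/eqP; rewrite eq_le c1]; rewrite e1 mulr1 in Ec.
pose s := Num.min 1 (sup E + d / 2).
have s1 : s <= 1 by rewrite ge_min lexx.
have sc : sup E < s by rewrite lt_min lt1 /=; lra.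
have sd : s <= sup E + d / 2 by rewrite ge_min lexx orbT.
have : E s.
  split; first by apply/andP; split=> //; lra.
  have := hd s; rewrite s1 ger0_norm; last by lra.
  have -> : 0 <= s by lra.
  move=> /(_ isT) h; have lt' : s - sup E < d by lra.
  have := h lt'; have := nrm_tri (p s) (p (sup E)) (p 0); lra.
by move=> /(ub_le_sup (proj2 supE)); rewrite leNgt sc.
Qed.

(** The map [f - J x] has small derivative near [x], so the preceding lemma applies to it along the
    segment from [z] to [y], which stays in the ball. *)
Lemma strict_diff x e : 0 < e -> exists d : R, 0 < d /\
  forall y z, nrm (y - x) < d -> nrm (z - x) < d ->
    nrm (f y - f z - J x *m (y - z)) <= e * nrm (y - z).
Proof.
move=> e0; have e2 : 0 < e / 2 by lra.
have [d [d0 hd]] := jacobian_cont x e2; exists d; split=> // y z hy hz.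
pose c (t : R) := z + t *: (y - z); pose p t := f (c t) - J x *m c t.
have cB s t : c s - c t = (s - t) *: (y - z) by rewrite /c; vring.
have -> : f y - f z - J x *m (y - z) = p 1 - p 0.
  rewrite /p /c scale1r scale0r addr0 [z + _]addrC subrK mulmxBr; vring.
apply: local_to_global_lipschitz; first by rewrite mulr_ge0 ?nrm_ge0 // ltW.
move=> t /andP[t0 t1].
have hc : nrm (c t - x) < d.
  have -> : c t - x = t *: (y - x) + (1 - t) *: (z - x) by rewrite /c; vring.
  apply: le_lt_trans (nrmD _ _) _; rewrite !nrmZp ?subr_ge0 //.
  have : t * nrm (y - x) + (1 - t) * nrm (z - x) <= Num.max (nrm (y - x)) (nrm (z - x)).
    have : t * nrm (y - x) <= t * Num.max (nrm (y - x)) (nrm (z - x)).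
      by rewrite ler_wpM2l // le_max lexx.
    have : (1 - t) * nrm (z - x) <= (1 - t) * Num.max (nrm (y - x)) (nrm (z - x)).
      by rewrite ler_wpM2l ?subr_ge0 // le_max lexx orbT.
    lra.
  by move=> h; apply: le_lt_trans h _; rewrite gt_max hy.
have [d' [d0' hd']] := fC1.1 (c t) _ e2.
have n0 := nrm_ge0 (y - z).
exists (d' / (nrm (y - z) + 1)); split; first by rewrite divr_gt0 //; lra.
move=> s _; rewrite ltr_pdivlMr; last by lra.
move=> hs; have cs : nrm (c s - c t) < d'.
  rewrite cB nrmZ; apply: le_lt_trans hs; rewrite ler_wpM2l //; lra.
have := hd' _ cs; have := hd _ hc (c s - c t).
have -> : p s - p t = (f (c s) - f (c t) - J (c t) *m (c s - c t)) + (J (c t) - J x) *m (c s - c t).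
  rewrite /p mulmxBl [J x *m (_ - _)]mulmxBr; vring.
have := nrmD (f (c s) - f (c t) - J (c t) *m (c s - c t)) ((J (c t) - J x) *m (c s - c t)).
rewrite [nrm (c s - c t)](congr1 nrm (cB s t)) nrmZ; lra.
Qed.

(** * Resolvents and Newton systems under strong monotonicity *)

Section StronglyMonotone.
Variable mu : R.
Hypotheses (mu0 : 0 < mu) (fmu : forall x1 x2, dotv (f x1 - f x2) (x1 - x2) >= mu * nrm (x1 - x2) ^+ 2).

Lemma add_mono_inj (lam : R) x y : 0 < lam -> x + lam *: f x = y + lam *: f y -> x = y.
Proof.
move=> l0 h; have := fmu x y.
have E : lam *: (f x - f y) = - (x - y).
  have -> : lam *: (f x - f y) = (x + lam *: f x) - (y + lam *: f y) - (x - y) by vring.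
  by rewrite h subrr sub0r.
rewrite -(ler_pM2l l0) -dotvZl E dotvNl nrm_sqr => h1.
have d0 := dotv_ge0 (x - y).
have /dotv_eq0/eqP : dotv (x - y) (x - y) = 0.
  apply/eqP; rewrite eq_le d0 andbT.
  have := mulr_ge0 (ltW l0) (mulr_ge0 (ltW mu0) d0); lra.
by rewrite subr_eq0 => /eqP.
Qed.

(** The norm of [y + lam f y - z] is coercive by monotonicity, so it has a minimiser [y]. If the
    residual [r] there were nonzero, moving to [y - t r] would decrease its norm for small [t]. *)
Lemma add_mono_surj (lam : R) z : 0 < lam -> exists y, y + lam *: f y = z.
Proof.
move=> l0; pose F y := nrm (y + lam *: f y - z).
have [||||y [_ hy]] := @attains_min _ _ (fun=> True) F 0 0 (F 0 + 1 + nrm z + lam * nrm (f 0)).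
- by [].
- by move=> x _; apply: nrm_ge0.
- move=> x _ hx.
  have h1 : nrm x <= nrm (x + lam *: (f x - f 0)).
    have [->|x0] := pselect (x = 0); first by rewrite nrm0 nrm_ge0.
    rewrite -(ler_pM2l (nrm_gt0 x0)); apply: le_trans (cauchy_schwarz _ _).
    have hm : 0 <= dotv x (f x - f 0).
      rewrite dotvC; have := fmu x 0; rewrite subr0; apply: le_trans.
      by rewrite mulr_ge0 ?sqr_ge0 // ltW.
    by rewrite -expr2 nrm_sqr (dotvDr x) dotvZr lerDl mulr_ge0 // ltW.
  apply: le_trans h1 _.
  have -> : x + lam *: (f x - f 0) = (x + lam *: f x - z) + z - lam *: f 0 by vring.
  have := nrmB (x + lam *: f x - z + z) (lam *: f 0); have := nrmD (x + lam *: f x - z) z.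
  rewrite nrmZp ?(ltW l0) // -/(F x); lra.
- move=> s l c _ sl Fs; split=> //.
  have := ucvg_nrm (ucvgVB (ucvgVD sl (ucvgVZ lam (f_ucvg sl))) (ucvgV_cst z)).
  by move=> /(ucvg_uniq Fs) ->.
exists y; apply: contrapT => ne.
have [r rE] : exists r, r = y + lam *: f y - z by eexists.
have r0 : r <> 0 by move=> r0; apply: ne; apply/eqP; rewrite -subr_eq0 -rE r0.
have rp := nrm_gt0 r0.
have [d [K [d0 K0 hK]]] := loc_lipschitz y.
pose C := 1 + lam * K.
have C1 : 1 <= C by rewrite /C lerDl mulr_ge0 // ltW.
have Cp : 0 < C ^+ 2 by rewrite exprn_gt0 //; lra.
(* The first bound keeps the trial point in the Lipschitz ball. The second makes the second-order
   term at most [t |r|^2], half of the first-order gain [2 t |r|^2]; monotonicity gives the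
   remaining cross term the favourable sign. *)
pose t := Num.min (d / (2 * nrm r)) (C ^+ 2)^-1.
have t0 : 0 < t by rewrite lt_min invr_gt0 Cp divr_gt0 ?mulr_gt0.
have tr : t * (2 * nrm r) <= d by rewrite -ler_pdivlMr ?mulr_gt0 // ge_min lexx.
have tC : t * C ^+ 2 <= 1 by rewrite -ler_pdivlMr // div1r ge_min lexx orbT.
have yd : y - t *: r - y = - (t *: r) by rewrite addrAC subrr add0r.
have := hK (y - t *: r); rewrite yd nrmN nrmZp ?(ltW t0) // => hf.
have {}hf : nrm (f (y - t *: r) - f y) <= K * (t * nrm r) by apply: hf; lra.
have := fmu (y - t *: r) y; rewrite yd nrmN nrmZp ?(ltW t0) //.
have := hy (y - t *: r) I; rewrite /F -rE.
have [D DE] : exists D, D = f (y - t *: r) - f y by eexists.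
have -> : y - t *: r + lam *: f (y - t *: r) - z = r - t *: r + lam *: D.
  have zE : z = y + lam *: f y - r by rewrite rE; vring.
  by rewrite zE DE; vring.
rewrite -DE in hf *; rewrite dotvNr dotvZr => h1 h2.
have hD : nrm (- (t *: r) + lam *: D) <= t * nrm r * C.
  apply: le_trans (nrmD _ _) _; rewrite nrmN !nrmZp ?(ltW t0) ?(ltW l0) //.
  have : lam * nrm D <= lam * (K * (t * nrm r)) by rewrite ler_pM2l.
  rewrite /C; lra.
have h3 : nrm r ^+ 2 <= nrm (r - t *: r + lam *: D) ^+ 2.
  by rewrite ler_pXn2r // nnegrE nrm_ge0.
have h4 : nrm (- (t *: r) + lam *: D) ^+ 2 <= (t * nrm r * C) ^+ 2.
  by rewrite ler_pXn2r // nnegrE ?nrm_ge0 // !mulr_ge0 ?nrm_ge0 ?(ltW t0) //; lra.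
have h5 : (t * nrm r * C) ^+ 2 <= t * nrm r ^+ 2.
  have -> : (t * nrm r * C) ^+ 2 = t * nrm r ^+ 2 * (t * C ^+ 2) by ring.
  by rewrite ger_pMr // mulr_gt0 // exprn_gt0.
have h6 : t * dotv D r <= 0.
  have := mulr_ge0 (ltW mu0) (sqr_ge0 (t * nrm r)); lra.
have {}h6 : dotv D r <= 0 by move: h6; rewrite pmulr_rle0.
have : 0 < t * nrm r ^+ 2 by rewrite mulr_gt0 // exprn_gt0.
move: h3 h4 h5; rewrite !nrm_sqr !dotvE (dotvC r D).
have : lam * dotv D r <= 0 by rewrite pmulr_rle0.
lra.
Qed.

(** With [j = J x h] and [r] the image of [h], one has [r = j - G (j - h)]. Applying [psd_sqr_le] to
    [j - h] gives [|r|^2 + <j, h> <= <r, j> + <r, h>], and [<j, h> >= mu |h|^2]. The constant thus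
    depends on [G] in no way, which is what the superlinear rate requires. *)
Lemma newton_system_bound (G : 'M[R]_n) x h (c : R) : G^T = G ->
  (forall v, 0 <= dotv v (G *m v)) -> (forall v, nrm (G *m v) <= nrm v) ->
  nrm (J x *m h) <= c * nrm h ->
  mu * nrm h <= (1 + c) * nrm (((1%:M - G) *m J x + G) *m h).
Proof.
move=> sG pG cG hc.
have [r rE] : exists r, r = ((1%:M - G) *m J x + G) *m h by eexists.
rewrite -rE; have [j jE] : exists j, j = J x *m h by eexists.
have hJ := jacobian_mono fmu x h; rewrite -jE in hc hJ.
have r2 : r = j - G *m (j - h).
  by rewrite rE mulmxDl -mulmxA -jE mulmxBl mul1mx mulmxBr; vring.
have := psd_sqr_le (j - h) sG pG cG.
have -> : G *m (j - h) = j - r by rewrite r2; vring.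
move=> h1; have h2 : mu * dotv h h <= dotv r j + dotv r h.
  have := dotv_ge0 r; move: h1 hJ.
  rewrite !dotvE (dotvC j r); lra.
have [h0|hn] := pselect (h = 0).
  by rewrite rE h0 mulmx0 !nrm0 !mulr0.
rewrite -(ler_pM2r (nrm_gt0 hn)) -mulrA -expr2 nrm_sqr; apply: le_trans h2 _.
have : nrm r * nrm j <= nrm r * (c * nrm h) by rewrite ler_wpM2l ?nrm_ge0.
have := cauchy_schwarz r j; have := cauchy_schwarz r h; lra.
Qed.

Lemma newton_system_unit (G : 'M[R]_n) x : G^T = G ->
  (forall v, 0 <= dotv v (G *m v)) -> (forall v, nrm (G *m v) <= nrm v) ->
  (1%:M - G) *m J x + G \in unitmx.
Proof.
move=> sG pG cG; apply: unitmx_of_ker => h Mh.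
have := newton_system_bound sG pG cG (nrm_mulmx (J x) h).
rewrite Mh nrm0 mulr0 pmulr_rle0 // => h0.
by apply: nrm_eq0; apply/eqP; rewrite eq_le h0 nrm_ge0.
Qed.
End StronglyMonotone.
End Smooth.


(** * The residual and the Douglas-Rachford step *)

Lemma geometric_small {R : realType} (c e : R) : 0 <= c < 1 -> 0 < e ->
  exists K, forall k, (K <= k)%N -> c ^+ k < e.
Proof.
move=> /andP[c0 c1] e0.
(* A Bernoulli-type bound, which makes the decay of the powers explicit. *)
have h k : c ^+ k * (1 + k%:R * (1 - c)) <= 1.
  elim: k => [|k IH]; first by rewrite expr0 mul0r addr0 mul1r.
  rewrite exprSr -mulrA; apply: le_trans (_ : c ^+ k * (1 + k%:R * (1 - c)) <= _) => //.
  rewrite ler_wpM2l ?exprn_ge0 // -natr1.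
  have k0 : 0 <= k%:R :> R by [].
  move: k0; move: (k%:R) => a a0.
  have := mulr_ge0 a0 (sqr_ge0 (1 - c)); have := sqr_ge0 (1 - c); lra.
have [K hK] := ex_nat_gt (e^-1 / (1 - c)).
exists K => k Kk; have d0 : 0 < 1 + k%:R * (1 - c).
  by rewrite ltr_pwDl // mulr_ge0 // subr_ge0 ltW.
apply: le_lt_trans (_ : (1 + k%:R * (1 - c))^-1 < _).
  by rewrite -[X in _ <= X]mul1r ler_pdivlMr.
rewrite invf_plt ?posrE //; move: hK; rewrite ltr_pdivrMr; last by lra.
move=> h1; apply: lt_le_trans h1 _; apply: le_trans (_ : k%:R * (1 - c) <= _); last by lra.
by rewrite ler_wpM2r ?ler_nat //; lra.
Qed.

Section Residual.
Context {R : realType} {n : nat}.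
Local Notation V := 'cV[R]_n.
Variables (f : V -> V) (J : V -> 'M[R]_n) (q : V -> \bar R) (gamma mu : R).
Hypotheses (fC1 : C1_with_jacobian f J) (qp : proper_fun q) (qc : convex_fun q) (ql : lsc_fun q).
Hypotheses (g0 : 0 < gamma) (mu0 : 0 < mu).
Hypothesis fmu : forall x1 x2, dotv (f x1 - f x2) (x1 - x2) >= mu * nrm (x1 - x2) ^+ 2.
Local Notation U := (u_gamma gamma f q).
Local Notation lam := gamma^-1.

Let l0 : 0 < lam. Proof. by rewrite invr_gt0. Qed.

Lemma residual_mono x y :
  0 <= dotv (- (gamma *: (U x - U y)) - (f x - f y)) ((x - y) + (U x - U y)).
Proof.
have -> : - (gamma *: (U x - U y)) - (f x - f y) =
    (- (gamma *: U x) - f x) - (- (gamma *: U y) - f y) by vring.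
have -> : (x - y) + (U x - U y) = (x + U x) - (y + U y) by vring.
exact: subdiff_mono qp _ _ _ _ (u_gammaP qp qc ql f x g0) (u_gammaP qp qc ql f y g0).
Qed.

(** The point [x + U x] is the resolvent of [lam * subdiff q] at [x - lam f x]; nonexpansiveness of
    the resolvent bounds [|e + w|] by [|e - g|]. *)
Lemma residual_lipschitz x y :
  nrm (U x - U y) <= 2 * nrm (x - y) + lam * nrm (f x - f y).
Proof.
have [e eE] : exists e, e = x - y by eexists.
have [w wE] : exists w, w = U x - U y by eexists.
have [g gE] : exists g, g = lam *: (f x - f y) by eexists.
have gn : nrm g = lam * nrm (f x - f y) by rewrite gE nrmZp // ltW.
have h := residual_mono x y; rewrite -eE -wE in h *; rewrite -gn.
have h1 : 0 <= dotv (- w - g) (e + w).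
  have -> : - w - g = lam *: (- (gamma *: w) - (f x - f y)).
    by rewrite scalerBr scalerN scalerA mulVf ?scale1r ?gE // lt0r_neq0.
  by rewrite dotvZl mulr_ge0 // ltW.
have h2 : nrm (e + w) <= nrm (e - g).
  have : dotv (e + w) (e + w) <= dotv (e + w) (e - g).
    move: h1; rewrite !dotvE (dotvC w e) (dotvC g e) (dotvC g w); lra.
  have [->|ne] := pselect (e + w = 0); first by rewrite nrm0 nrm_ge0.
  move=> h3; rewrite -(ler_pM2l (nrm_gt0 ne)) -expr2 nrm_sqr.
  by apply: le_trans h3 (cauchy_schwarz _ _).
have := nrmB (e + w) e; rewrite [e + w]addrC addrK; have := nrmB e g.
rewrite [w + e]addrC; lra.
Qed.

Lemma residual_loc_lipschitz x : exists d K : R, [/\ 0 < d, 0 <= K &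
  forall y, nrm (y - x) < d -> nrm (U y - U x) <= K * nrm (y - x)].
Proof.
have [d [K [d0 K0 h]]] := loc_lipschitz fC1 x.
exists d, (2 + lam * K); split=> //; first by rewrite addr_ge0 // mulr_ge0 // ltW.
move=> y /h hy; have := residual_lipschitz y x.
have : lam * nrm (f y - f x) <= lam * (K * nrm (y - x)) by rewrite ler_pM2l.
lra.
Qed.

Lemma residual_ucvg s l : ucvgV s l -> ucvgV (fun k => U (s k)) (U l).
Proof.
move=> sl; have [d [K [d0 K0 h]]] := residual_loc_lipschitz l.
have /(ucvgZ K) := (ucvgV_nrm _ _).1 sl; rewrite mulr0 => hK.
apply: (ucvgV_bound hK); apply: unear_mono (sl _ d0) => k; exact: h.
Qed.

(** Expanding [residual_mono] and dropping [gamma |w|^2] leaves [<F, e> <= - gamma <w, e> - <F, w>];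
    strong monotonicity bounds the left side below, Cauchy-Schwarz and the Lipschitz bound the right
    side above. *)
Lemma error_bound (L : R) x y : 0 <= L -> nrm (f x - f y) <= L * nrm (x - y) ->
  mu * nrm (x - y) <= (gamma + L) * nrm (U x - U y).
Proof.
move=> L0; have h := residual_mono x y; have hm := fmu x y; move: h hm.
have [e eE] : exists e, e = x - y by eexists.
have [w wE] : exists w, w = U x - U y by eexists.
have [F FE] : exists F, F = f x - f y by eexists.
rewrite -eE -wE -FE => h hm hL.
have [->|/nrm_gt0 ne] := pselect (e = 0).
  by rewrite nrm0 mulr0 mulr_ge0 ?nrm_ge0 // addr_ge0 // ltW.
rewrite -(ler_pM2r ne) -mulrA -expr2.
have h1 : nrm F * nrm w <= L * nrm e * nrm w by rewrite ler_wpM2r ?nrm_ge0.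
have h2 := cauchy_schwarzN F w; have h3 : - (gamma * (nrm w * nrm e)) <= gamma * dotv w e.
  by rewrite -mulrN ler_pM2l // cauchy_schwarzN.
have h4 := mulr_ge0 (ltW g0) (dotv_ge0 w).
move: h; rewrite !dotvE; lra.
Qed.

Lemma residual_eq0 x : H_map f q x 0 <-> U x = 0.
Proof.
split=> [h|h].
  by apply: u_gamma_eq => //; rewrite addr0 scaler0 oppr0.
by have := u_gammaP qp qc ql f x g0; rewrite h addr0 scaler0 oppr0.
Qed.

Lemma solution_uniq x y : U x = 0 -> U y = 0 -> x = y.
Proof.
move=> hx hy; have := residual_mono x y; have := fmu x y.
rewrite hx hy subrr scaler0 oppr0 sub0r addr0 dotvNl nrm_sqr => h1 h2.
have h3 : mu * dotv (x - y) (x - y) <= 0 by lra.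
have /dotv_eq0/eqP : dotv (x - y) (x - y) = 0.
  by apply/eqP; rewrite eq_le dotv_ge0 andbT -(pmulr_rle0 _ mu0).
by rewrite subr_eq0 => /eqP.
Qed.

(** The inner resolvent of the Douglas-Rachford operator returns [x + U x], so a step amounts to one
    equation for [y]. *)
Lemma DR_relE x y : DR_rel lam f q x y <-> y + lam *: f y = x + U x + lam *: f x.
Proof.
have gl : gamma != 0 by apply: lt0r_neq0.
have E p : lam^-1 *: (x - lam *: f x - p) = - (gamma *: (p - x)) - f x.
  by apply/matrixP => i j; rewrite !mxE; field.
split.
  move=> [p [hp ->]]; congr (_ + _).
  rewrite /resolvent_q E in hp.
  rewrite (@u_gamma_eq _ _ q qp qc ql gamma f x (p - x)) //; first by rewrite addrC subrK.
  by rewrite [x + _]addrC subrK.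
move=> h; exists (x + U x); split=> //; rewrite /resolvent_q E.
by rewrite [x + U x]addrC addrK [U x + x]addrC; apply: u_gammaP.
Qed.

Lemma DR_ex x : exists y, DR_rel lam f q x y /\ forall y', DR_rel lam f q x y' -> y' = y.
Proof.
have [y hy] := add_mono_surj fC1 mu0 fmu (x + U x + lam *: f x) l0.
exists y; split; first exact/DR_relE.
by move=> y' /DR_relE h; apply: (add_mono_inj mu0 fmu l0); rewrite h.
Qed.

(** Write [d = y - x] and [F = lam (f y - f x)], so that [U x = d + F]. Monotonicity of the
    subdifferential becomes [<d - U y, U y - F> >= 0], that is [|U y|^2 <= <U y, U x> - <d, F>], and
    strong monotonicity bounds [<d, F>] below. *)
Lemma DR_descent x y : DR_rel lam f q x y ->
  [/\ dotv (U y) (U y) <= dotv (U y) (U x) - lam * mu * dotv (y - x) (y - x) &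
      U x = (y - x) + lam *: (f y - f x)].
Proof.
move=> /DR_relE h.
have [d dE] : exists d, d = y - x by eexists.
have [F FE] : exists F, F = lam *: (f y - f x) by eexists.
have u0 : U x = d + F.
  have -> : U x = (x + U x + lam *: f x) - x - lam *: f x by vring.
  by rewrite -h dE FE; vring.
have hm := residual_mono y x; have := fmu y x; rewrite -dE -FE -u0.
split=> //.
have h1 : 0 <= dotv (d - U y) (U y - F).
  have -> : d - U y = lam *: (- (gamma *: (U y - U x)) - (f y - f x)).
    rewrite scalerBr -FE scalerN scalerA mulVf ?lt0r_neq0 // scale1r u0; vring.
  have -> : U y - F = y - x + (U y - U x) by rewrite -dE u0; vring.
  by rewrite dotvZl mulr_ge0 // ltW.
have h2 : lam * mu * dotv d d <= dotv F d.
  by rewrite FE dotvZl -mulrA ler_pM2l // -nrm_sqr.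
move: h1; rewrite u0 !dotvE (dotvC d (U y)) (dotvC d F); lra.
Qed.

Lemma DR_strict x y : DR_rel lam f q x y -> U x <> 0 -> nrm (U y) < nrm (U x).
Proof.
move=> /DR_descent [h uE] ne; have [d0|dn] := pselect (y - x = 0).
  have yx : y = x by apply/eqP; rewrite -subr_eq0 d0.
  by case: ne; rewrite uE yx !subrr scaler0 addr0.
have p : 0 < lam * mu * dotv (y - x) (y - x).
  by rewrite mulr_gt0 ?mulr_gt0 // -nrm_sqr exprn_gt0 // nrm_gt0.
have h2 : nrm (U y) * nrm (U y) < nrm (U y) * nrm (U x).
  rewrite -expr2 nrm_sqr; have := cauchy_schwarz (U y) (U x); lra.
rewrite ltNge; apply/negP => le; move: h2; rewrite ltNge => /negP; apply.
by rewrite ler_wpM2l ?nrm_ge0.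
Qed.

Lemma DR_le x y : DR_rel lam f q x y -> nrm (U y) <= nrm (U x).
Proof.
move=> h; have [e|ne] := pselect (U x = 0); last exact/ltW/DR_strict.
have [h1 _] := DR_descent h; rewrite e nrm0.
apply: nrm_le => //; rewrite expr0n /=; move: h1; rewrite e dotv0r.
have := mulr_ge0 (mulr_ge0 (ltW l0) (ltW mu0)) (dotv_ge0 (y - x)); lra.
Qed.

(** By the Lipschitz bound [|U x| <= (1 + lam L) |y - x|], so the gain in [DR_descent] is at least
    [c |U x|^2]. With [a = |U x|] and [b = |U y|] this reads [b^2 <= a b - c a^2], and adding
    [(a - b)^2 >= 0] gives [b <= (1 - c) a]. *)
Lemma DR_contraction (L : R) x y : 0 <= L -> DR_rel lam f q x y ->
  nrm (f y - f x) <= L * nrm (y - x) ->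
  nrm (U y) <= (1 - lam * mu / (1 + lam * L) ^+ 2) * nrm (U x).
Proof.
move=> L0 h hL; have [h1 uE] := DR_descent h; have hle := DR_le h.
set c := _ / _; set A := 1 + lam * L.
have A0 : 0 < A by rewrite ltr_pwDl // mulr_ge0 // ltW.
have hu : nrm (U x) <= A * nrm (y - x).
  rewrite uE; apply: le_trans (nrmD _ _) _; rewrite nrmZp ?(ltW l0) //.
  have : lam * nrm (f y - f x) <= lam * (L * nrm (y - x)) by rewrite ler_pM2l.
  rewrite /A; lra.
have hc : c * nrm (U x) ^+ 2 <= lam * mu * dotv (y - x) (y - x).
  have : nrm (U x) ^+ 2 <= (A * nrm (y - x)) ^+ 2.
    by rewrite ler_pXn2r // nnegrE ?nrm_ge0 // mulr_ge0 ?nrm_ge0 // ltW.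
  rewrite exprMn nrm_sqr => h2.
  have -> : lam * mu * dotv (y - x) (y - x) = c * (A ^+ 2 * dotv (y - x) (y - x)).
    by rewrite /c mulrA divfK // expf_neq0 // lt0r_neq0.
  rewrite nrm_sqr in h2 *; rewrite ler_wpM2l // divr_ge0 ?sqr_ge0 // mulr_ge0 // ltW //.
have [e|/nrm_gt0 ne] := pselect (U x = 0); first by rewrite e nrm0 mulr0 in hle *.
move: c (lam * mu * _) hc h1 => c r hc h1.
rewrite -nrm_sqr in h1; rewrite mulrBl mul1r -(ler_pM2r ne).
have := cauchy_schwarz (U y) (U x); have := sqr_ge0 (nrm (U x) - nrm (U y)).
move: hc h1; move: (nrm (U x)) (nrm (U y)) (dotv _ _) => a b d; lra.
Qed.

(** The Douglas-Rachford step decreases the residual strictly, so the right side of the test exceeds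
    [|U x1|] by about [xi (|U x0| - |U x1|)]. This slack absorbs the change of [U] along a short
    step, whatever the direction. *)
Lemma line_search_ex nu xi (beta : nat -> R) x0 x1 G dx :
  0 < nu < 1 -> 0 < xi < 1 -> beta_ok beta -> DR_rel lam f q x0 x1 ->
  newton_dir gamma f J q x1 (U x1) G dx ->
  exists j, ls_cond gamma nu xi beta f q x1 dx (U x0) (U x1) j.
Proof.
move=> /andP[nu0 nu1] /andP[xi0 xi1] [b0 [bp [_ bcv]]] hDR [[sG [pG [cG _]]] hdx].
have hle := DR_le hDR.
(* At a solution there is no slack, but then [U x1 = 0], the Newton system forces [dx = 0], and the
   full step passes. *)
have [e|ne] := pselect (U x0 = 0).
  rewrite e nrm0 in hle.
  have e1 : U x1 = 0 by apply: nrm_eq0; apply/eqP; rewrite eq_le nrm_ge0 hle.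
  have dx0 : dx = 0.
    have M := newton_system_unit fC1 mu0 fmu x1 sG pG cG.
    by rewrite -[dx](mulKmx M) hdx e1 !mulmx0.
  by exists 0%N; rewrite /ls_cond dx0 scaler0 addr0 e1 e nrm0 !mulr0 addr0 mulr0.
have lt := DR_strict hDR ne.
have [d [K [d0 K0 hK]]] := residual_loc_lipschitz x1.
pose A := K * nrm dx + nu * nrm (U x0) + 1.
have A0 : 0 < A by rewrite ltr_wpDl // addr_ge0 ?mulr_ge0 ?nrm_ge0 // ltW.
pose e := Num.min (xi * (nrm (U x0) - nrm (U x1)) / A) (d / (nrm dx + 1)).
have nd := nrm_ge0 dx.
have dxp : 0 < nrm dx + 1 by lra.
have e0 : 0 < e by rewrite lt_min !divr_gt0 ?mulr_gt0 // subr_gt0.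
have [j hj] := bcv _ e0; exists j; have := hj j (leqnn j).
have bj := bp j; rewrite subr0 gtr0_norm // lt_min !ltr_pdivlMr // => /andP[h1 h2].
have hn : nrm (x1 + beta j *: dx - x1) = beta j * nrm dx.
  by rewrite addrAC subrr add0r nrmZp // ltW.
have := hK (x1 + beta j *: dx); rewrite hn => hh.
have {}hh : nrm (U (x1 + beta j *: dx) - U x1) <= K * (beta j * nrm dx) by apply: hh; lra.
have := nrmD (U (x1 + beta j *: dx) - U x1) (U x1); rewrite subrK /ls_cond => h3.
have h4 : nu * beta j * (xi * nrm (U x0) + (1 - xi) * nrm (U x1)) <= nu * beta j * nrm (U x0).
  rewrite ler_wpM2l ?mulr_ge0 ?(ltW nu0) ?(ltW bj) //.
  rewrite -subr_ge0 (_ : _ - _ = (1 - xi) * (nrm (U x0) - nrm (U x1))); last by ring.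
  by rewrite mulr_ge0 // subr_ge0 ltW.
rewrite /A in h1; lra.
Qed.

End Residual.


(** * Semismoothness *)

Section Semismooth.
Context {R : realType} {n : nat}.
Local Notation V := 'cV[R]_n.

Lemma reg_normalZ (Om : set (V * V)) z w (a : R) : 0 < a -> reg_normal Om z w ->
  reg_normal Om z (pscale a w).
Proof.
move=> a0 [zO h]; split=> // e e0.
have [d [d0 hd]] := h (e / a) (divr_gt0 e0 a0); exists d; split=> // z' z'O hz.
have := hd z' z'O hz; rewrite mulrAC ler_pdivlMr // mulrC; apply: le_trans.
by rewrite /dotp !dotvZl mulrDr.
Qed.

Lemma nrmpZ (a : R) (w : V * V) : 0 <= a -> nrmp (pscale a w) = a * nrmp w.
Proof.
move=> a0; rewrite /nrmp /dotp /pscale /= !dotvE.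
have -> : a * (a * dotv w.1 w.1) + a * (a * dotv w.2 w.2) = a ^+ 2 * (dotv w.1 w.1 + dotv w.2 w.2) by ring.
by rewrite sqrtrM ?sqr_ge0 // sqrtr_sqr ger0_norm.
Qed.

Lemma cvgP_ucvg (z : nat -> V * V) l : Defs.cvgP z l ->
  ucvgV (fun k => (z k).1) l.1 /\ ucvgV (fun k => (z k).2) l.2.
Proof.
move=> hz; split=> e /hz [K hK]; apply: (@unear_eventually _ K) => k /hK; apply: le_lt_trans.
  exact: (nrm1_le_nrmp (psub (z k) l)).
exact: (nrm2_le_nrmp (psub (z k) l)).
Qed.

(** Violating pairs on balls of radius [1 / (k + 1)] are normalised, both the displacement and the
    normal, and their limits form a directional limiting normal on which the semismoothness identity
    fails by at least [e]. *)
Lemma semismooth_star_estimate (F : V -> V -> Prop) x y : F x y -> semismooth_star F x y ->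
  forall e : R, 0 < e -> exists d : R, 0 < d /\
  forall z w, reg_normal (gph F) z w -> nrmp (psub z (x, y)) < d ->
    `|dotp w (psub z (x, y))| <= e * nrmp w * nrmp (psub z (x, y)).
Proof.
move=> Fxy ss e e0; apply: contrapT => bad.
have hk (k : nat) : exists zw : (V * V) * (V * V), [/\ reg_normal (gph F) zw.1 zw.2,
    nrmp (psub zw.1 (x, y)) < k.+1%:R^-1 &
    e * nrmp zw.2 * nrmp (psub zw.1 (x, y)) < `|dotp zw.2 (psub zw.1 (x, y))| ].
  apply: contrapT => no; apply: bad; exists k.+1%:R^-1; split; first by rewrite invr_gt0 ltr0Sn.
  move=> z w zw hz; rewrite leNgt; apply/negP => lt; apply: no.
  by exists (z, w).
have [zw hzw] := choice hk.
pose z k := (zw k).1; pose w k := (zw k).2; pose t k := nrmp (psub (z k) (x, y)).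
have CSp (a b : V * V) : `|dotp a b| <= 2 * nrmp a * nrmp b.
  apply: le_trans (ler_normD _ _) _.
  have h1 : `|dotv a.1 b.1| <= nrmp a * nrmp b.
    by apply: le_trans (cauchy_schwarz_abs _ _) _; apply: ler_pM; rewrite ?nrm_ge0 ?nrm1_le_nrmp.
  have h2 : `|dotv a.2 b.2| <= nrmp a * nrmp b.
    by apply: le_trans (cauchy_schwarz_abs _ _) _; apply: ler_pM; rewrite ?nrm_ge0 ?nrm2_le_nrmp.
  by apply: le_trans (lerD h1 h2) _; lra.
have pos k : 0 < nrmp (w k) /\ 0 < t k.
  have [_ _ h] := hzw k; have w0 := nrmp_ge0 (w k); have t0 := nrmp_ge0 (psub (z k) (x, y)).
  have h1 := CSp (w k) (psub (z k) (x, y)); rewrite -/(w k) -/(z k) in h.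
  rewrite -/(t k) in h h1 t0 *; have h2 := lt_le_trans h h1.
  rewrite !lt_neqAle w0 t0 !andbT; split; apply/eqP => e1; rewrite -e1 ?mulr0 ?mul0r ?ltxx // in h2.
pose d k := pscale (t k)^-1 (psub (z k) (x, y)).
pose v k := pscale (nrmp (w k))^-1 (w k).
have d1 k : nrmp (d k) = 1.
  by rewrite nrmpZ ?invr_ge0 ?mulVf ?lt0r_neq0 ?(ltW (proj2 (pos k))) //; case: (pos k).
have v1 k : nrmp (v k) = 1.
  by rewrite nrmpZ ?invr_ge0 ?mulVf ?lt0r_neq0 ?(ltW (proj1 (pos k))) //; case: (pos k).
have vd k : e < `|dotp (v k) (d k)|.
  have [w0 t0] := pos k; have [_ _ h] := hzw k; rewrite -/(w k) -/(z k) -/(t k) in h.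
  have -> : dotp (v k) (d k) = (nrmp (w k) * t k)^-1 * dotp (w k) (psub (z k) (x, y)).
    by rewrite /dotp /= !dotvE; field; rewrite !lt0r_neq0.
  rewrite normrM gtr0_norm ?invr_gt0 ?mulr_gt0 // ltr_pdivlMl ?mulr_gt0 //.
  by apply: le_lt_trans h; rewrite mulrC mulrA.
have [a1 ha1] : exists l, ucvgV (fun k => (d k).1) l.
  by apply: (@ucvgV_bounded _ _ _ 1) => k; rewrite -(d1 k) nrm1_le_nrmp.
have [a2 ha2] : exists l, ucvgV (fun k => (d k).2) l.
  by apply: (@ucvgV_bounded _ _ _ 1) => k; rewrite -(d1 k) nrm2_le_nrmp.
have [b1 hb1] : exists l, ucvgV (fun k => (v k).1) l.
  by apply: (@ucvgV_bounded _ _ _ 1) => k; rewrite -(v1 k) nrm1_le_nrmp.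
have [b2 hb2] : exists l, ucvgV (fun k => (v k).2) l.
  by apply: (@ucvgV_bounded _ _ _ 1) => k; rewrite -(v1 k) nrm2_le_nrmp.
(* Directional normals are defined by ordinary sequences, so a selection with rate [1 / (m + 1)] is
   extracted from the ultralimits; [m <= k] forces the step lengths [t] to zero. *)
have sel (m : nat) : exists k, [/\ (m <= k)%N, nrmp (psub (d k) (a1, a2)) <= 2 * m.+1%:R^-1 &
    nrmp (psub (v k) (b1, b2)) <= 2 * m.+1%:R^-1].
  have m0 : 0 < m.+1%:R^-1 :> R by rewrite invr_gt0 ltr0Sn.
  have [k mk [[h1 h2] [h3 h4]]] := unear_ex_ge m (unear_and (unear_and (ha1 _ m0) (ha2 _ m0)) (unear_and (hb1 _ m0) (hb2 _ m0))).
  by exists k; split=> //; apply: le_trans (nrmp_le_sum _) _;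
    rewrite mulr_natl mulr2n; apply: lerD; apply: ltW; assumption.
have [s hs] := choice sel.
have : dir_coderiv F x y a1 a2 (- b2) b1.
  split=> //; exists (t \o s), (d \o s), (v \o s); rewrite opprK.
  split; first by move=> k; case: (pos (s k)).
  split.
    move=> e' e'0; have [K hK] := ex_nat_gt e'^-1; exists K => k Kk.
    rewrite subr0 ger0_norm; last by case: (pos (s k)) => _ /ltW.
    have [_ h _] := hzw (s k); apply: lt_trans h _.
    rewrite invf_plt ?posrE // ?invr_gt0 ?ltr0Sn //; apply: lt_le_trans hK _.
    rewrite ler_nat; apply: leq_trans Kk _; apply: leqW; by case: (hs k).
  split; first by apply: (cvgP_bound (C := 2)) => k; case: (hs k).
  split; first by apply: (cvgP_bound (C := 2)) => k; case: (hs k).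
  move=> k /=; have -> : padd (x, y) (pscale (t (s k)) (d (s k))) = z (s k).
    rewrite /padd /pscale /d /= !scalerA divff ?lt0r_neq0 ?(proj2 (pos _)) // !scale1r.
    by rewrite [x + _]addrC [y + _]addrC !subrK; case: (z (s k)).
  apply: reg_normalZ; last by case: (hzw (s k)).
  by rewrite invr_gt0; case: (pos (s k)).
move=> /ss; rewrite dotvNl => h.
have lim := ucvgD (ucvg_dot hb1 ha1) (ucvg_dot hb2 ha2).
have [k] := unear_ex (lim _ e0); rewrite h addNr subr0 => lt.
by have := vd k; rewrite ltNge => /negP; apply; apply: ltW.
Qed.

Variables (f : V -> V) (J : V -> 'M[R]_n) (q : V -> \bar R).
Hypothesis fC1 : C1_with_jacobian f J.

Lemma H_map_shift p y : subdiff q p y <-> H_map f q p (y + f p).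
Proof. by rewrite /H_map addrK. Qed.

(** The graph of [H] is the image of the graph of the subdifferential under the shear
    [(p, y) |-> (p, y + f p)]; normals are transported by the inverse transpose of its derivative,
    the remainder of [f] at [p] being of first-order smallness. *)
Lemma reg_normal_shift p y a b : reg_normal (gph (subdiff q)) (p, y) (a, b) ->
  reg_normal (gph (H_map f q)) (p, y + f p) (a - (J p)^T *m b, b).
Proof.
move=> [hz hreg]; split; first exact: (H_map_shift _ _).1 hz.
move=> e e0.
have [dK [K [dK0 K0 hK]]] := loc_lipschitz fC1 p.
have nb := nrm_ge0 b.
have e1 : 0 < e / (2 * (2 + K)) by rewrite divr_gt0 // mulr_gt0 //; lra.
have e2 : 0 < e / (2 * (nrm b + 1)) by rewrite divr_gt0 // mulr_gt0 //; lra.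
have [d1 [d10 h1]] := hreg _ e1; have [d2 [d20 h2]] := fC1.1 p _ e2.
exists (Num.min (Num.min dK d2) (d1 / (2 + K))); split.
  by rewrite !lt_min dK0 d20 divr_gt0 //; lra.
move=> -[p' y'] hz'; have hO : gph (subdiff q) (p', y' - f p') by exact: hz'.
have := nrm1_le_nrmp (psub (p', y') (p, y + f p)).
have := nrm2_le_nrmp (psub (p', y') (p, y + f p)).
set N := nrmp _; rewrite /= => n2 n1; rewrite !lt_min => /andP[/andP[ltK lt2] lt1].
have hKp := hK _ (le_lt_trans n1 ltK); have h2p := h2 _ (le_lt_trans n1 lt2).
have KN : K * nrm (p' - p) <= K * N by rewrite ler_wpM2l.
have lt1' : (2 + K) * N < d1 by rewrite mulrC -ltr_pdivlMr //; lra.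
have hN : nrmp (psub (p', y' - f p') (p, y)) <= (2 + K) * N.
  apply: le_trans (nrmp_le_sum _) _; rewrite /=.
  have -> : y' - f p' - y = (y' - (y + f p)) - (f p' - f p) by vring.
  have := nrmB (y' - (y + f p)) (f p' - f p); lra.
have := h1 _ hO (le_lt_trans hN lt1'); rewrite /dotp /= => h3.
have e1N : e / (2 * (2 + K)) * nrmp (psub (p', y' - f p') (p, y)) <= e / 2 * N.
  apply: le_trans (_ : e / (2 * (2 + K)) * ((2 + K) * N) <= _); first by rewrite ler_pM2l.
  by rewrite le_eqVlt; apply/orP; left; apply/eqP; field; rewrite lt0r_neq0 //; lra.
have h4 : dotv b (f p' - f p - J p *m (p' - p)) <= e / 2 * N.
  apply: le_trans (cauchy_schwarz _ _) _.
  apply: le_trans (_ : (nrm b + 1) * (e / (2 * (nrm b + 1)) * nrm (p' - p)) <= _).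
    apply: ler_pM => //; [exact: nrm_ge0|lra].
  have -> : (nrm b + 1) * (e / (2 * (nrm b + 1)) * nrm (p' - p)) = e / 2 * nrm (p' - p).
    by field; rewrite lt0r_neq0 //; lra.
  by rewrite ler_pM2l // divr_gt0.
have -> : dotv (a - (J p)^T *m b) (p' - p) + dotv b (y' - (y + f p)) =
    (dotv a (p' - p) + dotv b (y' - f p' - y)) + dotv b (f p' - f p - J p *m (p' - p)).
  by rewrite (dotvBl a) (dotv_mulmx (J p)^T) trmxK !(dotvDr, dotvNr); ring.
lra.
Qed.

Variable xbar : V.
Hypotheses (sol : H_map f q xbar 0) (ss : semismooth_star (H_map f q) xbar 0).

Lemma jacobian_bound x : exists d c : R, [/\ 0 < d, 0 <= c &
  forall y, nrm (y - x) < d -> forall h, nrm (J y *m h) <= c * nrm h].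
Proof.
have [d [d0 hd]] := jacobian_cont fC1 x (ltr01 : 0 < 1 :> R).
exists d, (1 + mxnorm1 (J x)); split=> //; first by rewrite addr_ge0 ?mxnorm1_ge0.
move=> y /hd hy h; have := hy h; have := nrm_mulmx (J x) h.
have := nrmD ((J y - J x) *m h) (J x *m h); rewrite mulmxBl subrK; lra.
Qed.

(** The estimate for regular normals of [H] is pulled back through the shear, and every term is
    continuous in the base point and the normal, so it extends to limiting normals, the ones by
    which Newton matrices are defined. *)
Lemma subdiff_semismooth_estimate : exists c : R, 0 <= c /\ forall e : R, 0 < e ->
  exists d : R, 0 < d /\ forall p y a b,
    nrm (p - xbar) < d -> nrm (y + f p) < d -> lim_normal (gph (subdiff q)) (p, y) (a, b) ->
    `|dotv a (p - xbar) - dotv b (J p *m (p - xbar)) + dotv b (y + f p)| <=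
      e * (nrm a + c * nrm b) * (nrm (p - xbar) + nrm (y + f p)).
Proof.
have [dJ [cJ [dJ0 cJ0 hJ]]] := jacobian_bound xbar.
(* The normal [(a - J^T b, b)] has norm at most [|a| + cJ |b| + |b|]. *)
exists (cJ + 1); split=> [|e e0]; first by lra.
have [d [d0 hd]] := semismooth_star_estimate sol ss e0.
pose D := Num.min dJ (d / 2).
have D0 : 0 < D by rewrite lt_min dJ0 divr_gt0.
exists D; split=> // p y a b hp hy [_ [zk [wk [hreg [hz hw]]]]].
have [zcv1 zcv2] := cvgP_ucvg hz; have [wcv1 wcv2] := cvgP_ucvg hw; rewrite /= in zcv1 zcv2 wcv1 wcv2.
have vcv := ucvgVB zcv1 (ucvgV_cst xbar).
have scv := ucvgVD zcv2 (f_ucvg fC1 zcv1).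
have Jcv : ucvgV (fun k => J (zk k).1 *m ((zk k).1 - xbar)) (J p *m (p - xbar)).
  apply: (ucvgV_bound (a := fun k => nrm ((J (zk k).1 - J p) *m ((zk k).1 - xbar)) + mxnorm1 (J p) * nrm ((zk k).1 - p))).
    rewrite -[0](addr0 0); apply: ucvgD; last first.
      by rewrite -[0](mulr0 (mxnorm1 (J p))); apply: ucvgZ; apply/ucvgV_nrm.
    move=> e' e'0; have B0 : 0 < nrm (p - xbar) + 1 by have := nrm_ge0 (p - xbar); lra.
    have [d' [d'0 hd']] := jacobian_cont fC1 p (divr_gt0 (divr_gt0 e'0 B0) (ltr0Sn R 1)).
    apply: unear_mono (unear_and (zcv1 _ d'0) (ucvg_nrm vcv ltr01)) => k [/hd' h1 h2].
    rewrite subr0 ger0_norm ?nrm_ge0 //; apply: le_lt_trans (h1 _) _.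
    have h3 : nrm ((zk k).1 - xbar) <= nrm (p - xbar) + 1.
      by move: h2; rewrite ltr_norml; lra.
    apply: le_lt_trans (_ : e' / (nrm (p - xbar) + 1) / 2 * (nrm (p - xbar) + 1) < _).
      by rewrite ler_wpM2l // !divr_ge0 // ltW.
    by rewrite mulrAC divfK ?lt0r_neq0 //; lra.
  apply: (@unear_eventually _ 0) => k _.
  have -> : J (zk k).1 *m ((zk k).1 - xbar) - J p *m (p - xbar) =
      (J (zk k).1 - J p) *m ((zk k).1 - xbar) + J p *m ((zk k).1 - p).
    by rewrite mulmxBl !mulmxBr; vring.
  apply: le_trans (nrmD _ _) _; rewrite lerD2l; exact: nrm_mulmx.
have L1 := ucvgD (ucvgB (ucvg_dot wcv1 vcv) (ucvg_dot wcv2 Jcv)) (ucvg_dot wcv2 scv).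
have L2 := ucvgM (ucvgZ e (ucvgD (ucvg_nrm wcv1) (ucvgZ (cJ + 1) (ucvg_nrm wcv2))))
  (ucvgD (ucvg_nrm vcv) (ucvg_nrm scv)).
have near : unear (fun k => `|dotv (wk k).1 ((zk k).1 - xbar) -
      dotv (wk k).2 (J (zk k).1 *m ((zk k).1 - xbar)) + dotv (wk k).2 ((zk k).2 + f (zk k).1)| <=
    e * (nrm (wk k).1 + (cJ + 1) * nrm (wk k).2) *
      (nrm ((zk k).1 - xbar) + nrm ((zk k).2 + f (zk k).1))).
  have small (s : nat -> V) l : ucvgV s l -> nrm l < D -> unear (fun k => nrm (s k) < D).
    move=> sl lD; have g : 0 < D - nrm l by lra.
    by apply: unear_mono (ucvg_nrm sl g) => k; rewrite ltr_norml; lra.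
  apply: unear_mono (unear_and (small _ _ vcv hp) (small _ _ scv hy)) => k [].
  case: (zk k) (wk k) (hreg k) => p' y' [a' b'] /= /reg_normal_shift hr.
  rewrite !lt_min => /andP[p1 p2] /andP[_ y2].
  have Nle : nrmp (psub (p', y' + f p') (xbar, 0)) <= nrm (p' - xbar) + nrm (y' + f p').
    by apply: le_trans (nrmp_le_sum _) _; rewrite /= subr0.
  have := hd _ _ hr; rewrite /dotp /= subr0 (dotvBl a') (dotv_mulmx (J p')^T) trmxK => h.
  have {}h := h _; apply: le_trans (h _) _.
    by apply: le_lt_trans Nle _; lra.
  (* The bound on [J] passes to its transpose through [|J^T b|^2 = <b, J (J^T b)>]. *)
  have Jb : nrm ((J p')^T *m b') <= cJ * nrm b'.
    have [->|ne] := pselect ((J p')^T *m b' = 0).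
      by rewrite nrm0 mulr_ge0 ?nrm_ge0.
    rewrite -(ler_pM2r (nrm_gt0 ne)) -expr2 nrm_sqr dotv_mulmx trmxK.
    apply: le_trans (cauchy_schwarz _ _) _; rewrite -mulrA [nrm b' * _]mulrC mulrA [cJ * _]mulrC mulrC.
    have := hJ _ p1 ((J p')^T *m b'); have := nrm_ge0 b'; nra.
  apply: ler_pM; rewrite ?mulr_ge0 ?nrmp_ge0 ?(ltW e0) // ler_pM2l //.
  apply: le_trans (nrmp_le_sum _) _; rewrite /=.
  have := nrmB a' ((J p')^T *m b'); lra.
rewrite ler_norml; apply/andP; split.
  rewrite lerNl; apply: ucvg_le (ucvgN L1) L2 _.
  by apply: unear_mono near => k; rewrite ler_norml lerNl => /andP[].
by apply: ucvg_le L1 L2 _; apply: unear_mono near => k; rewrite ler_norml => /andP[].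
Qed.
End Semismooth.


(** * Convergence of the algorithm *)

Section Convergence.
Context {R : realType} {n : nat}.
Local Notation V := 'cV[R]_n.
Variables (f : V -> V) (J : V -> 'M[R]_n) (q : V -> \bar R) (gamma mu : R).
Hypotheses (fC1 : C1_with_jacobian f J) (qp : proper_fun q) (qc : convex_fun q) (ql : lsc_fun q).
Hypotheses (g0 : 0 < gamma) (mu0 : 0 < mu).
Hypothesis fmu : forall x1 x2, dotv (f x1 - f x2) (x1 - x2) >= mu * nrm (x1 - x2) ^+ 2.
Local Notation U := (u_gamma gamma f q).
Local Notation lam := gamma^-1.

(** The graph point belonging to [x] is the value of the resolvent [P] at the sum of its two
    components. *)
Lemma newton_G_ex x : exists G, newton_G gamma f q x (U x) G.
Proof.
have [P [hP Pq]] := prox_ex qp qc ql.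
have [G [sG pG cG hG]] := newton_matrix_ex hP Pq (prox_nonexpansive qp hP)
  ((x + U x) + (- (gamma *: U x) - f x)) (prox_potential qp hP).
exists G; split=> //; split=> //; split=> // v; move: (hG v).
by rewrite (Pq _ _ (u_gammaP qp qc ql f x g0)) [X in coderiv _ _ X]addrC addKr.
Qed.

(** The first group, tested against [v], is exactly the quantity that semismoothness controls for
    the normal [(G v, - (1 - G) v)] at [(p, y)]; the second collects differentiability errors of
    [f]. *)
Lemma newton_step_identity (G : 'M[R]_n) (x xb u p y dx : V) : p = x + u -> y = - (gamma *: u) - f x ->
  ((1%:M - G) *m J x + G) *m dx = (gamma *: (1%:M - G) + G) *m u ->
  ((1%:M - G) *m J x + G) *m (x + dx - xb) =
    (G *m (p - xb) + (1%:M - G) *m (J p *m (p - xb) - (y + f p))) +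
    (1%:M - G) *m ((J x - J xb) *m (x - xb) - (J p - J xb) *m (p - xb) - (f x - f p - J xb *m (x - p))).
Proof.
move=> pE yE hdx; rewrite -[RHS]addrA -[in RHS]mulmxDr.
have [A AE] : exists A, A = 1%:M - G by eexists.
have hM : ((1%:M - G) *m J x + G) *m (x + dx - xb) =
    A *m (J x *m (x - xb) + gamma *: u) + (G *m (x - xb) + G *m u).
  have -> : x + dx - xb = (x - xb) + dx by vring.
  rewrite [LHS]mulmxDr hdx -AE mulmxDl -mulmxA mulmxDl -scalemxAl scalemxAr.
  by rewrite [A *m (_ + _)]mulmxDr addrACA.
rewrite hM -AE [LHS]addrC; congr (_ + _).
  by rewrite -mulmxDr pE; congr (G *m _); vring.
congr (A *m _).
have -> : x - p = - u by rewrite pE; vring.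
have -> : p - xb = (x - xb) + u by rewrite pE; vring.
by rewrite !mulmxBl yE mulmxN !(mulmxDr _ (x - xb)); vring.
Qed.

Lemma newton_step_estimate xbar : H_map f q xbar 0 -> semismooth_star (H_map f q) xbar 0 ->
  forall e : R, 0 < e -> exists d : R, 0 < d /\ forall x G dx, nrm (x - xbar) < d ->
    newton_dir gamma f J q x (U x) G dx -> nrm (x + dx - xbar) <= e * nrm (x - xbar).
Proof.
move=> sol ss e e0.
have U0 : U xbar = 0 by apply/residual_eq0.
have [c [c0 hest]] := subdiff_semismooth_estimate fC1 sol ss.
have [dU [KU [dU0 KU0 hU]]] := residual_loc_lipschitz fC1 qp qc ql g0 xbar.
have [dJ [cJ [dJ0 cJ0 hJ]]] := jacobian_bound fC1 xbar.
have [d3 [d30 h3]] := strict_diff fC1 xbar (ltr01 : 0 < 1 :> R).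
pose Lf := 1 + mxnorm1 (J xbar).
have Lf0 : 0 <= Lf by rewrite addr_ge0 ?mxnorm1_ge0.
pose B := (gamma + Lf) * KU.
have B0 : 0 <= B by rewrite mulr_ge0 // addr_ge0 // ltW.
(* The first summand comes from the semismooth term, where [|p - xbar|] and [|y + f p|] are together
   at most [(1 + KU + B) |x - xbar|]; the rest comes from the three differentiability errors. Then
   [e1] cancels [A2] and the constant of the Newton system. *)
pose A2 := (1 + c) * (1 + KU + B) + 2 + 2 * KU.
have A20 : 0 < A2.
  have : 0 <= (1 + c) * (1 + KU + B) by rewrite mulr_ge0 ?addr_ge0.
  by rewrite /A2; lra.
pose e1 := e * mu / ((1 + cJ) * A2).
have D0 : 0 < (1 + cJ) * A2 by rewrite mulr_gt0 //; lra.
have e10 : 0 < e1 by rewrite divr_gt0 // mulr_gt0.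
have [d1 [d10 h1]] := hest e1 e10.
have [d2 [d20 h2]] := strict_diff fC1 xbar e10.
have [d4 [d40 h4]] := jacobian_cont fC1 xbar e10.
pose m := Num.min (Num.min (Num.min d1 d2) (Num.min d3 d4)) (Num.min dU dJ).
have m0 : 0 < m by rewrite !lt_min d10 d20 d30 d40 dU0 dJ0.
have K1 : 0 < 1 + KU + B by rewrite -addrA ltr_pwDl // addr_ge0.
exists (m / (1 + KU + B)); split; first by rewrite divr_gt0.
move=> x G dx; rewrite ltr_pdivlMr // => hx [[sG [pG [cG hG]]] hdx].
set X := nrm (x - xbar) in hx *.
have X0 : 0 <= X by apply: nrm_ge0.
have hx' : X + KU * X + B * X < m by rewrite mulrC !mulrDl mul1r in hx.
have BX : 0 <= B * X by rewrite mulr_ge0.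
have KX : 0 <= KU * X by rewrite mulr_ge0.
have hm r : r <= X + KU * X + B * X -> r < m by move=> h; apply: le_lt_trans h hx'.
have lt_all r : r < m -> [/\ r < d1, r < d2, r < d3 & r < d4] /\ (r < dU /\ r < dJ).
  by rewrite !lt_min => /andP[/andP[/andP[-> ->] /andP[-> ->]] /andP[-> ->]].
have xm : X < m by apply: hm; rewrite -addrA lerDl addr_ge0.
have [[x1 x2 x3 x4] [xU xJ]] := lt_all _ xm.
have [u uE] : exists u, u = U x by eexists.
have hu : nrm u <= KU * X by have := hU _ xU; rewrite U0 subr0 -uE.
have [p pE] : exists p, p = x + u by eexists.
have [y yE] : exists y, y = - (gamma *: u) - f x by eexists.
have hp : nrm (p - xbar) <= X + KU * X.
  have -> : p - xbar = (x - xbar) + u by rewrite pE; vring.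
  by apply: le_trans (nrmD _ _) _; rewrite lerD2l.
have pm : nrm (p - xbar) < m by apply: hm; apply: le_trans hp _; rewrite lerDl.
have [[p1 p2 p3 p4] _] := lt_all _ pm.
have px : nrm (x - p) = nrm u by rewrite nrmBC pE addrC addKr.
have hy : nrm (y + f p) <= B * X.
  have -> : y + f p = - (gamma *: u) - (f x - f p) by rewrite yE; vring.
  have := h3 _ _ x3 p3; rewrite mul1r px => h5.
  have := nrm_mulmx (J xbar) (x - p); rewrite px => h6.
  have := nrmD (f x - f p - J xbar *m (x - p)) (J xbar *m (x - p)); rewrite subrK => h7.
  have := nrmB (- (gamma *: u)) (f x - f p); rewrite nrmN nrmZp ?(ltW g0) // => h8.
  have h9 : nrm (- (gamma *: u) - (f x - f p)) <= (gamma + Lf) * nrm u by rewrite /Lf; lra.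
  by apply: le_trans h9 _; rewrite /B -mulrA ler_wpM2l // addr_ge0 // ltW.
have ym' : nrm (y + f p) < m.
  by apply: hm; apply: le_trans hy _; rewrite lerDr addr_ge0.
have [[ym _ _ _] _] := lt_all _ ym'.
have sCG : (1%:M - G)^T = 1%:M - G by rewrite linearB /= trmx1 sG.
have cCG := fun v => psd_compl_contraction v sG pG cG.
have [r1 r1E] : exists r1, r1 = G *m (p - xbar) + (1%:M - G) *m (J p *m (p - xbar) - (y + f p)).
  by eexists.
have hr1 : nrm r1 <= e1 * (1 + c) * (1 + KU + B) * X.
  (* One matrix [G] yields a normal for every [v], so the scalar estimate holds in all directions;
     taking [v = r1] turns it into a bound on [|r1|]. *)
  have est v : dotv v r1 <= e1 * (1 + c) * nrm v * (X + KU * X + B * X).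
    have := hG v; rewrite -uE -pE -yE => hc.
    have := h1 _ _ _ _ p1 ym hc.
    have -> : dotv (G *m v) (p - xbar) - dotv (- ((1%:M - G) *m v)) (J p *m (p - xbar)) +
        dotv (- ((1%:M - G) *m v)) (y + f p) = dotv v r1.
      rewrite r1E (dotv_mulmx G) sG !dotvNl !(dotv_mulmx (1%:M - G)) sCG.
      by rewrite [(1%:M - G) *m (_ - (_ + _))]mulmxBr (dotvDr (G *m _)) dotvBr; ring.
    move=> h; apply: le_trans (ler_norm _) _; apply: le_trans h _.
    have nv := nrm_ge0 v.
    have s1 : nrm (G *m v) + c * nrm (- ((1%:M - G) *m v)) <= (1 + c) * nrm v.
      by rewrite nrmN mulrDl mul1r; apply: lerD => //; rewrite ler_wpM2l.
    have s2 := lerD hp hy.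
    apply: le_trans (ler_wpM2l _ s2) _.
      by rewrite mulr_ge0 ?(ltW e10) // addr_ge0 ?nrm_ge0 // mulr_ge0 ?nrm_ge0.
    rewrite -[e1 * (1 + c) * _]mulrA ler_wpM2r ?ler_pM2l //.
    exact: le_trans (addr_ge0 (nrm_ge0 _) (nrm_ge0 _)) s2.
  have [->|ne] := pselect (r1 = 0).
    by rewrite nrm0 mulr_ge0 // mulr_ge0 ?(ltW K1) // mulr_ge0 ?(ltW e10) // addr_ge0.
  rewrite -(ler_pM2r (nrm_gt0 ne)) -expr2 nrm_sqr; apply: le_trans (est _) _; lra.
have [t tE] : exists t, t = (J x - J xbar) *m (x - xbar) - (J p - J xbar) *m (p - xbar)
    - (f x - f p - J xbar *m (x - p)) by eexists.
have ht : nrm t <= e1 * (2 + 2 * KU) * X.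
  have t1 := h4 _ x4 (x - xbar); have t2 := h4 _ p4 (p - xbar); have t3 := h2 _ _ x2 p2.
  rewrite px in t3.
  have := nrmB ((J x - J xbar) *m (x - xbar) - (J p - J xbar) *m (p - xbar))
    (f x - f p - J xbar *m (x - p)); rewrite -tE.
  have := nrmB ((J x - J xbar) *m (x - xbar)) ((J p - J xbar) *m (p - xbar)).
  have : e1 * nrm (p - xbar) <= e1 * (X + KU * X) by rewrite ler_pM2l.
  have : e1 * nrm u <= e1 * (KU * X) by rewrite ler_pM2l.
  rewrite -/X in t1; lra.
rewrite -uE in hdx; have id := newton_step_identity xbar pE yE hdx.
rewrite -r1E -tE in id.
have hM : nrm (((1%:M - G) *m J x + G) *m (x + dx - xbar)) <= e1 * A2 * X.
  by rewrite id; apply: le_trans (nrmD _ _) _; have := cCG t; rewrite /A2; lra.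
have := newton_system_bound fC1 fmu sG pG cG (hJ _ xJ (x + dx - xbar)).
have h5 : (1 + cJ) * nrm (((1%:M - G) *m J x + G) *m (x + dx - xbar)) <= (1 + cJ) * (e1 * A2 * X).
  by rewrite ler_wpM2l // addr_ge0.
move=> h6; rewrite -(ler_pM2l mu0); apply: le_trans h6 _; apply: le_trans h5 _.
by rewrite le_eqVlt; apply/orP; left; apply/eqP; rewrite /e1; field; rewrite !lt0r_neq0 //; lra.
Qed.
End Convergence.


(** * Rates of convergence along a run *)

Section Run.
Context {R : realType} {n : nat}.
Local Notation V := 'cV[R]_n.
Variables (f : V -> V) (J : V -> 'M[R]_n) (q : V -> \bar R) (gamma mu nu xi : R) (beta : nat -> R).
Hypotheses (fC1 : C1_with_jacobian f J) (qp : proper_fun q) (qc : convex_fun q) (ql : lsc_fun q).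
Hypotheses (g0 : 0 < gamma) (mu0 : 0 < mu).
Hypothesis fmu : forall x1 x2, dotv (f x1 - f x2) (x1 - x2) >= mu * nrm (x1 - x2) ^+ 2.
Hypotheses (nu01 : 0 < nu < 1) (xi01 : 0 < xi < 1) (bok : beta_ok beta).
Local Notation U := (u_gamma gamma f q).
Local Notation lam := gamma^-1.

Lemma algorithm_well_defined : well_defined gamma nu xi beta f J q.
Proof.
split; last split; last split; last split.
- move=> x; have [u hu] := is_u_gamma_ex qp qc ql f x g0.
  by exists u; split=> // u'; apply: (is_u_gamma_uniq qp qc g0 hu).
- exact: DR_ex fC1 qp qc ql g0 mu0 fmu.
- exact: newton_G_ex.
- by move=> x G [sG [pG [cG _]]]; exact: (newton_system_unit fC1 mu0 fmu x sG pG cG).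
- move=> x0 x1 G dx hDR hN.
  exact: (line_search_ex fC1 qp qc ql g0 mu0 fmu nu01 xi01 bok hDR hN).
Qed.

Variable x : nat -> V.
Hypothesis run : alg_run gamma nu xi beta f J q x.
Hypothesis flip : lipschitz_on f [set y | nrm (U y) <= nrm (U (x 0%N))].

Lemma run_DR_le k : nrm (U (x k.*2.+1)) <= nrm (U (x k.*2)).
Proof. by have [h _] := run k; exact: (DR_le qp qc ql g0 mu0 fmu h). Qed.

Lemma run_newton_le k :
  nrm (U (x k.+1.*2)) <= xi * nrm (U (x k.*2)) + (1 - xi) * nrm (U (x k.*2.+1)).
Proof.
have [_ [G [dx [j [_ [ls [_ hx]]]]]]] := run k; have [_ [bp _]] := bok.
case/andP: nu01 => nu0 _; case/andP: xi01 => xi0 xi1.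
rewrite doubleS hx; apply: le_trans ls _.
rewrite mulrBl mul1r gerBl mulr_ge0 ?mulr_ge0 ?(ltW nu0) ?(ltW (bp j)) //.
by rewrite addr_ge0 // mulr_ge0 ?nrm_ge0 ?subr_ge0 // ltW.
Qed.

Lemma run_even_le k : nrm (U (x k.*2)) <= nrm (U (x 0%N)).
Proof.
elim: k => [//|k IH]; apply: le_trans IH; apply: le_trans (run_newton_le k) _.
case/andP: xi01 => _ xi1; have := run_DR_le k => h.
have : (1 - xi) * nrm (U (x k.*2.+1)) <= (1 - xi) * nrm (U (x k.*2)).
  by rewrite ler_wpM2l ?subr_ge0 // ltW.
lra.
Qed.

(** The acceptance test allows at most an average of the residuals before and after the
    Douglas-Rachford step; the contraction factor [1 - c] of that step enters with weight
    [1 - xi]. *)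
Lemma run_linear : exists L kap : R, [/\ 0 <= L, 0 < kap < 1,
  forall y z, nrm (U y) <= nrm (U (x 0%N)) -> nrm (U z) <= nrm (U (x 0%N)) ->
    nrm (f y - f z) <= L * nrm (y - z) &
  forall k, nrm (U (x k.+1.*2)) <= kap * nrm (U (x k.*2))].
Proof.
have [L0 hL0] := flip; case/andP: (xi01) => xi0 xi1.
(* Enlarging the Lipschitz constant to at least [mu] makes it nonnegative and ensures [c < 1], so
   that [kap] is positive. *)
pose L := Num.max L0 mu.
have muL : mu <= L by rewrite le_max lexx orbT.
have Lp : 0 <= L by apply: le_trans muL; apply: ltW.
have hL y z : nrm (U y) <= nrm (U (x 0%N)) -> nrm (U z) <= nrm (U (x 0%N)) ->
    nrm (f y - f z) <= L * nrm (y - z).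
  move=> hy hz; apply: le_trans (hL0 y z hy hz) _.
  by rewrite ler_wpM2r ?nrm_ge0 // le_max lexx.
pose c := lam * mu / (1 + lam * L) ^+ 2.
have l0 : 0 < lam by rewrite invr_gt0.
have A0 : 0 < 1 + lam * L by rewrite ltr_pwDl // mulr_ge0 // ltW.
have c0 : 0 < c by rewrite divr_gt0 ?exprn_gt0 // mulr_gt0.
have c1 : c < 1.
  rewrite ltr_pdivrMr ?exprn_gt0 // mul1r.
  have : lam * mu <= lam * L by rewrite ler_pM2l.
  have := mulr_ge0 (ltW l0) Lp; move: (lam * mu) (lam * L) => a b; nra.
exists L, (1 - (1 - xi) * c); split=> //.
  have : 0 < (1 - xi) * c by rewrite mulr_gt0 // subr_gt0.
  have : (1 - xi) * c < 1 * 1.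
    by apply: ltr_pM => //; rewrite ?subr_ge0 ?(ltW c0) ?(ltW xi1) // gtrDl oppr_lt0.
  lra.
move=> k; apply: le_trans (run_newton_le k) _.
have [hDR _] := run k.
have hk := run_even_le k; have hk1 := le_trans (run_DR_le k) hk.
have := DR_contraction qp qc ql g0 mu0 fmu Lp hDR (hL _ _ hk1 hk); rewrite -/c => h.
have : (1 - xi) * nrm (U (x k.*2.+1)) <= (1 - xi) * ((1 - c) * nrm (U (x k.*2))).
  by rewrite ler_wpM2l // subr_ge0 ltW.
move: (nrm _) (nrm _) => a b; lra.
Qed.

Lemma run_even_geometric (kap : R) : 0 <= kap ->
  (forall k, nrm (U (x k.+1.*2)) <= kap * nrm (U (x k.*2))) ->
  forall k, nrm (U (x k.*2)) <= kap ^+ k * nrm (U (x 0%N)).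
Proof.
move=> k0 h; elim=> [|k IH]; first by rewrite expr0 mul1r.
apply: le_trans (h k) _; rewrite exprS -mulrA ler_wpM2l //.
Qed.

Lemma run_residual_le j : nrm (U (x j)) <= nrm (U (x j./2.*2)).
Proof.
rewrite -{1}(odd_double_half j); case: (odd j) => /=; last by rewrite add0n.
exact: run_DR_le.
Qed.

(** The error bound against the starting point keeps the even iterates bounded. They have an
    ultralimit, and there the residual vanishes by continuity and geometric decay. *)
Lemma run_limit : exists xbar, U xbar = 0.
Proof.
have [L [kap [L0 /andP[kap0 kap1] hL hk]]] := run_linear.
have geo := run_even_geometric (ltW kap0) hk.
have U0 := nrm_ge0 (U (x 0%N)).
have bd k : nrm (x k.*2) <= nrm (x 0%N) + (gamma + L) / mu * (2 * nrm (U (x 0%N))).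
  have hk2 := run_even_le k.
  have := error_bound qp qc ql g0 fmu L0 (hL _ _ hk2 (lexx _)).
  have := nrmB (U (x k.*2)) (U (x 0%N)) => h1 h2.
  have h3 : nrm (x k.*2 - x 0%N) <= (gamma + L) / mu * (2 * nrm (U (x 0%N))).
    rewrite mulrAC ler_pdivlMr // mulrC; apply: le_trans h2 _.
    by rewrite ler_wpM2l ?addr_ge0 ?(ltW g0) //; lra.
  by have := nrmD (x k.*2 - x 0%N) (x 0%N); rewrite subrK; lra.
have [xbar hx] := ucvgV_bounded bd; exists xbar.
have := residual_ucvg fC1 qp qc ql g0 hx => hU.
apply: ucvgV_uniq hU _ => e e0.
have e1 : 0 < e / (nrm (U (x 0%N)) + 1) by rewrite divr_gt0 //; lra.
have [K hK] := geometric_small (c := kap) (introT andP (conj (ltW kap0) kap1)) e1.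
apply: (@unear_eventually _ K) => k /hK; rewrite subr0 ltr_pdivlMr; last by lra.
move=> h; apply: le_lt_trans h; apply: le_trans (geo k) _.
by rewrite ler_wpM2l ?exprn_ge0 ?(ltW kap0) //; lra.
Qed.

Lemma run_error_bound xbar : U xbar = 0 -> exists C : R, 0 <= C /\
  forall j, nrm (x j - xbar) <= C * nrm (U (x j)).
Proof.
move=> hx; have [L [kap [L0 _ hL _]]] := run_linear.
exists ((gamma + L) / mu); split; first by rewrite divr_ge0 ?addr_ge0 // ltW.
move=> j; have hj := le_trans (run_residual_le j) (run_even_le _).
have hb : nrm (U xbar) <= nrm (U (x 0%N)) by rewrite hx nrm0 nrm_ge0.
have := error_bound qp qc ql g0 fmu L0 (hL _ _ hj hb).
by rewrite hx subr0 mulrAC ler_pdivlMr // mulrC.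
Qed.

(** One factor [kap] is gained per two indices, so the rate per index is its square root; the
    division by [c] in the constant compensates for odd indices, which inherit the bound of the
    preceding even one. *)
Lemma run_R_linear xbar : U xbar = 0 -> R_linear x xbar.
Proof.
move=> hx; have [C [C0 hC]] := run_error_bound hx.
have [L [kap [L0 /andP[kap0 kap1] hL hk]]] := run_linear.
have geo := run_even_geometric (ltW kap0) hk.
pose c := Num.sqrt kap.
have c0 : 0 < c by rewrite sqrtr_gt0.
have c2 : c ^+ 2 = kap by rewrite sqr_sqrtr // ltW.
have c1 : c < 1 by rewrite -(expr_lt1 (n := 2)) ?c2 // ltW.
exists (C * nrm (U (x 0%N)) / c), c.
have CU : 0 <= C * nrm (U (x 0%N)) by rewrite mulr_ge0 ?nrm_ge0.
split; first by rewrite divr_ge0 // ltW.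
split; first by rewrite (ltW c0).
move=> j; apply: le_trans (hC j) _.
have h1 : nrm (U (x j)) <= c ^+ (j./2.*2) * nrm (U (x 0%N)).
  have -> : c ^+ (j./2.*2) = kap ^+ j./2 by rewrite -mul2n exprM c2.
  exact: le_trans (run_residual_le j) (geo _).
have h2 : c ^+ (j./2.*2) * c <= c ^+ j.
  rewrite -exprSr ler_wiXn2l ?(ltW c0) ?(ltW c1) //.
  by rewrite -{1}(odd_double_half j); case: (odd j).
have h3 : c ^+ (j./2.*2) <= c ^+ j / c by rewrite ler_pdivlMr.
have h4 : C * nrm (U (x j)) <= C * (c ^+ (j./2.*2) * nrm (U (x 0%N))) by rewrite ler_wpM2l.
apply: le_trans h4 _.
have h5 : C * nrm (U (x 0%N)) * c ^+ (j./2.*2) <= C * nrm (U (x 0%N)) * (c ^+ j / c) by rewrite ler_wpM2l.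
by move: h5; rewrite !mulrA [_ * c ^+ _]mulrAC; lra.
Qed.

Lemma R_linear_cvg (a : nat -> V) l : R_linear a l -> cvgV a l.
Proof.
move=> [C [c [C0 [c01 h]]]] e e0.
have e1 : 0 < e / (C + 1) by rewrite divr_gt0 //; lra.
have [K hK] := geometric_small c01 e1; exists K => k /hK; rewrite ltr_pdivlMr; last by lra.
move=> h1; apply: le_lt_trans (h k) _; apply: le_lt_trans h1.
by rewrite mulrC ler_wpM2l ?exprn_ge0 ?lerDl //; case/andP: c01.
Qed.

Lemma run_superlinear xbar : U xbar = 0 -> semismooth_star (H_map f q) xbar 0 ->
  Q_superlinear (fun k => x k.*2) xbar.
Proof.
move=> hx ss; have sol : H_map f q xbar 0 := (residual_eq0 f qp qc ql g0 xbar).2 hx.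
have cvx := R_linear_cvg (run_R_linear hx).
have [C [C0 hC]] := run_error_bound hx.
have [dU [KU [dU0 KU0 hU]]] := residual_loc_lipschitz fC1 qp qc ql g0 xbar.
case/andP: (nu01) => nu0 nu1; case/andP: (xi01) => xi0 xi1; have [b0 _] := bok.
have cvx2 : cvgV (fun k => x k.*2) xbar.
  move=> e /cvx [K hK]; exists K => k Kk; apply: hK; apply: leq_trans Kk _.
  by rewrite -addnn leq_addr.
split=> // e e0.
pose D := C * KU + 1.
have CK : 0 <= C * KU by rewrite mulr_ge0.
have D0 : 0 < D by rewrite /D; lra.
(* The three bounds serve in turn to keep the full Newton point where [U] is Lipschitz at [xbar], to
   get the full step accepted, and to give the factor [e] after passing from [x k.*2.+1] back to
   [x k.*2]. *)
pose e1 := Num.min (Num.min 1 ((1 - nu) / D)) (e / D).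
have e10 : 0 < e1 by rewrite !lt_min ltr01 !divr_gt0 //; lra.
have e1D : e1 * D <= e by rewrite -ler_pdivlMr // ge_min lexx orbT.
have e1nu : e1 * D <= 1 - nu by rewrite -ler_pdivlMr // !ge_min lexx orbT.
have e11 : e1 <= 1 by rewrite !ge_min lexx.
have [d [d0 hd]] := newton_step_estimate fC1 qp qc ql g0 mu0 fmu sol ss e10.
have m0 : 0 < Num.min d dU by rewrite lt_min d0.
have [K hK] := cvx _ m0; exists K => k Kk.
have Kk2 : (K <= k.*2)%N by apply: leq_trans Kk _; rewrite -addnn leq_addr.
have := hK _ Kk2; have := hK _ (leqW Kk2); rewrite !lt_min => /andP[x1d x1U] /andP[_ x0U].
have [hDR [G [dx [j [hN [ls [lmin hnext]]]]]]] := run k.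
have est := hd _ _ _ x1d hN.
set X1 := nrm (x k.*2.+1 - xbar) in est x1d x1U.
have X10 : 0 <= X1 by apply: nrm_ge0.
have hb := run_DR_le k; have u1 := nrm_ge0 (U (x k.*2.+1)).
have hX1 : X1 <= C * nrm (U (x k.*2.+1)) by apply: hC.
(* At the full step the residual is at most [KU * e1 * C * |U x1| <= (1 - nu) |U x1|], where [x1] is
   the Douglas-Rachford point; this is below the threshold because [|U x1|] does not exceed the
   preceding residual. Minimality of [j] then leaves only [0]. *)
have j0 : j = 0%N.
  apply/eqP; rewrite -leqn0 leqNgt; apply/negP => /lmin; apply.
  rewrite /ls_cond b0 scale1r mulr1.
  have ty : nrm (x k.*2.+1 + dx - xbar) < dU.
    apply: le_lt_trans est _; apply: le_lt_trans x1U.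
    by rewrite -[X in _ <= X]mul1r ler_wpM2r.
  have := hU _ ty; rewrite hx subr0 => h1; apply: le_trans h1 _.
  have h2 : KU * nrm (x k.*2.+1 + dx - xbar) <= KU * (e1 * (C * nrm (U (x k.*2.+1)))).
    rewrite ler_wpM2l //; apply: le_trans est _; by rewrite ler_wpM2l // ltW.
  apply: le_trans h2 _.
  have h3 : KU * (e1 * (C * nrm (U (x k.*2.+1)))) <= (1 - nu) * nrm (U (x k.*2.+1)).
    have : (e1 * D) * nrm (U (x k.*2.+1)) <= (1 - nu) * nrm (U (x k.*2.+1)) by rewrite ler_wpM2r.
    have := mulr_ge0 (ltW e10) u1; rewrite /D; lra.
  apply: le_trans h3 _; rewrite ler_wpM2l ?subr_ge0 ?(ltW nu1) //.
  have : xi * nrm (U (x k.*2.+1)) <= xi * nrm (U (x k.*2)) by rewrite ler_pM2l.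
  lra.
rewrite doubleS hnext j0 b0 scale1r; apply: le_trans est _.
have h0 := hU _ x0U; rewrite hx subr0 in h0.
(* Distances to [xbar] are compared through the residual, which the Douglas-Rachford step does not
   increase. *)
have hX1' : X1 <= C * KU * nrm (x k.*2 - xbar).
  apply: le_trans hX1 _; rewrite -mulrA ler_wpM2l //; exact: le_trans hb h0.
have hX0 := nrm_ge0 (x k.*2 - xbar).
have h6 : e1 * X1 <= e1 * (C * KU * nrm (x k.*2 - xbar)) by rewrite ler_pM2l.
have h7 : e1 * D * nrm (x k.*2 - xbar) <= e * nrm (x k.*2 - xbar) by rewrite ler_wpM2r.
have := mulr_ge0 (ltW e10) hX0; rewrite /D in h7; lra.
Qed.
End Run.

Theorem theorem5p2 (R : realType) (n : nat)
  (f : 'cV[R]_n -> 'cV[R]_n) (J : 'cV[R]_n -> 'M[R]_n) (q : 'cV[R]_n -> \bar R)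
  (gamma nu xi : R) (beta : nat -> R) :
  C1_with_jacobian f J ->
  proper_fun q -> convex_fun q -> lsc_fun q ->
  0 < gamma -> 0 < nu < 1 -> 0 < xi < 1 -> beta_ok beta ->
  strongly_monotone f ->
  well_defined gamma nu xi beta f J q /\
  forall x : nat -> 'cV[R]_n,
    alg_run gamma nu xi beta f J q x ->
    (forall k, 0 < r_gamma gamma f q (x k.*2)) ->
    lipschitz_on f [set y | nrm (u_gamma gamma f q y) <= nrm (u_gamma gamma f q (x 0%N))] ->
    Q_linear_to0 (fun k => u_gamma gamma f q (x k.*2)) /\
    exists xbar : 'cV[R]_n,
      H_map f q xbar 0 /\ (forall y, H_map f q y 0 -> y = xbar) /\
      R_linear x xbar /\
      (semismooth_star (H_map f q) xbar 0 -> Q_superlinear (fun k => x k.*2) xbar).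
Proof.
move=> fC1 qp qc ql g0 nu01 xi01 bok [mu [mu0 fmu]]; split.
  exact: (algorithm_well_defined fC1 qp qc ql g0 mu0 fmu nu01 xi01 bok).
move=> x run _ flip.
have [L [kap [_ /andP[kap0 kap1] _ hk]]] :=
  run_linear qp qc ql g0 mu0 fmu nu01 xi01 bok run flip.
split; first by exists kap; rewrite (ltW kap0) kap1; split=> //; exists 0%N => k _; apply: hk.
have [xbar Ux] := run_limit fC1 qp qc ql g0 mu0 fmu nu01 xi01 bok run flip.
exists xbar; split; first exact: (residual_eq0 f qp qc ql g0 xbar).2 Ux.
split; first by move=> y /(residual_eq0 f qp qc ql g0) Uy;
  apply: (solution_uniq qp qc ql g0 mu0 fmu Uy Ux).
split; first exact: (run_R_linear qp qc ql g0 mu0 fmu nu01 xi01 bok run flip Ux).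
move=> ss; exact: (run_superlinear fC1 qp qc ql g0 mu0 fmu nu01 xi01 bok run flip Ux ss).
Qed.
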